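(* For every $\alpha\in(0,1)$ one has $$\mathbf{M}_\alpha\;\prec_{st}\;\Gamma(1-\alpha)\,\mathbf{L}\qquad\text{and}\qquad\Gamma(1+\alpha)\,\mathbf{M}_\alpha\;\prec_{cx}\;\mathbf{L}.$$
   Context: For $\alpha\in(0,1)$, $\mathbf{Z}_\alpha$ is the positive random variable with $\mathbb{E}[e^{-\lambda \mathbf{Z}_\alpha}]=e^{-\lambda^\alpha}$ for all $\lambda\ge0$, and $\mathbf{M}_\alpha$ is the Mittag-Leffler random variable, defined in law by $\mathbf{M}_\alpha\stackrel{d}{=}\mathbf{Z}_\alpha^{-\alpha}$. $\mathbf{L}$ is the unit exponential random variable. For real random variables $X,Y$, write $X\le_{st}Y$ if $\mathbb{P}[X\ge x]\le\mathbb{P}[Y\ge x]$ for all $x\in\mathbb{R}$. For positive random variables $X,Y$, the optimal stochastic order $X\prec_{st}Y$ means that $X\le_{st}Y$ and there is no $c>1$ such that $cX\le_{st}Y$. The convex order $X\prec_{cx}Y$ means that $\mathbb{E}[\varphi(X)]\le\mathbb{E}[\varphi(Y)]$ for all convex functions $\varphi$ such that the expectations exist. *)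

(* Defs.v *)
From HB Require Import structures.
From mathcomp Require Import all_boot all_order all_algebra.
From mathcomp Require Import all_classical all_reals all_analysis.
Set Implicit Arguments.
Unset Strict Implicit.
Unset Printing Implicit Defensive.
Import Order.TTheory GRing.Theory Num.Theory.
Import numFieldNormedType.Exports.
Local Open Scope classical_set_scope.
Local Open Scope ring_scope.

(* Meaningful for 0 < s only: [Rintegral] is 0 when the integral diverges. *)
Definition Gamma (R : realType) (s : R) : R :=
  \int[lebesgue_measure]_(x in `]0, +oo[) (x `^ (s - 1) * expR (- x)).

Definition same_law (R : realType)
    (d : measure_display) (T : measurableType d) (P : probability T R)
    (X : T -> R)
    (d' : measure_display) (T' : measurableType d') (Q : probability T' R)
    (Y : T' -> R) : Prop :=
  forall B : set R, measurable B -> pushforward P X B = pushforward Q Y B.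

(* Z has the law of the positive stable variable Z_a.  Random variables are
   only specified in law, so positivity is almost sure. *)
Definition positive_stable (R : realType) (a : R)
    (d : measure_display) (T : measurableType d) (P : probability T R)
    (Z : {RV P >-> R}) : Prop :=
  {ae P, forall w, 0 < Z w} /\
  forall l : R, 0 <= l ->
    ('E_P[fun w => expR (- (l * Z w))] = (expR (- (l `^ a)))%:E)%E.

(* M = Z_a `^ (- a) in law; Z_a may live on another probability space. *)
Definition mittag_leffler (R : realType) (a : R)
    (d : measure_display) (T : measurableType d) (P : probability T R)
    (M : {RV P >-> R}) : Prop :=
  exists (d' : measure_display) (T' : measurableType d')
      (Q : probability T' R) (Z : {RV Q >-> R}),
    positive_stable a Z /\ same_law P M Q (fun w => Z w `^ (- a)).

Definition unit_exponential (R : realType)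
    (d : measure_display) (T : measurableType d) (P : probability T R)
    (L : {RV P >-> R}) : Prop :=
  forall B : set R, measurable B ->
    pushforward P L B = exponential_prob (1 : R) B.

Definition st_le (R : realType)
    (d : measure_display) (T : measurableType d) (P : probability T R)
    (X : T -> R)
    (d' : measure_display) (T' : measurableType d') (Q : probability T' R)
    (Y : T' -> R) : Prop :=
  forall x : R, (P [set w | (x <= X w)%R] <= Q [set w | (x <= Y w)%R])%E.

Definition optimal_st (R : realType)
    (d : measure_display) (T : measurableType d) (P : probability T R)
    (X : T -> R)
    (d' : measure_display) (T' : measurableType d') (Q : probability T' R)
    (Y : T' -> R) : Prop :=
  st_le P X Q Y /\
  ~ (exists c : R, 1 < c /\ st_le P (fun w => c * X w) Q Y).

(* The expectation is well defined in [-oo, +oo]: not of the form oo - oo. *)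
Definition expectation_exists (R : realType)
    (d : measure_display) (T : measurableType d) (P : probability T R)
    (X : T -> R) : Prop :=
  (\int[P]_w ((EFin \o X)^\+ w) < +oo \/
   \int[P]_w ((EFin \o X)^\- w) < +oo)%E.

Definition cx_le (R : realType)
    (d : measure_display) (T : measurableType d) (P : probability T R)
    (X : T -> R)
    (d' : measure_display) (T' : measurableType d') (Q : probability T' R)
    (Y : T' -> R) : Prop :=
  forall phi : R -> R, convex_function (setT : set R) phi ->
    expectation_exists P (phi \o X) ->
    expectation_exists Q (phi \o Y) ->
    ('E_P[phi \o X] <= 'E_Q[phi \o Y])%E.

(* Main.v *)
(** Let [Z] be positive [a]-stable, [N = Z `^ (- a)] and [L] unit exponential,
    with [L] independent of [Z].  Conditioning on [Z],
    [P (N L^a > y) = E (exp (- y^(1/a) Z)) = exp (- y)], so [N L^a] has the law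
    of [L].  As [E (L^a) = Gamma (1 + a)], Jensen's inequality conditionally on
    [N] gives the convex order.  If [c N] were stochastically smaller than
    [Gamma (1 - a) L], then [exp (- x) = P (N L^a > x)] would be at most
    [E (exp (- (c / Gamma (1 - a)) x L^(- a)))]; since
    [E (L^(- a)) = Gamma (1 - a)], letting [x] tend to 0 forces [c <= 1].

    For the stochastic order, [E (Z exp (- l Z)) = a l^(a - 1) exp (- l^a)] and
    the determinacy of bounded variables by their moments give
    [E (Z g(Z)) = a / Gamma (1 - a) E (int_0^oo g(Z + s) s^(- a) ds)].  Taking
    for [g] the indicator of [[t, u]] divided by [x] and keeping only the event
    [Z < t], the survival function [G] of [N] satisfies
    [G(c) (1 + (c - b) / Gamma (1 - a)) <= G(b)] for [0 < b < c]; iterating along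
    an arithmetic progression yields [G(x) <= exp (- x / Gamma (1 - a))]. *)
Require Import Defs.
From HB Require Import structures.
From mathcomp Require Import all_boot all_order all_algebra.
From mathcomp Require Import all_classical all_reals all_analysis.
From mathcomp Require Import measurable_realfun.
From mathcomp Require Import ring lra.
Import Order.TTheory GRing.Theory Num.Theory.
Import numFieldNormedType.Exports.
Local Open Scope classical_set_scope.
Local Open Scope ring_scope.
Set Implicit Arguments.
Unset Strict Implicit.
Unset Printing Implicit Defensive.

(** * Convex functions on the line *)

Section convexity.
Context (R : realType) (phi : R -> R).
Hypothesis phi_convex : convex_function (setT : set R) phi.

Lemma convex_functionP (x y t : R) : 0 <= t <= 1 ->
  phi (t * x + (1 - t) * y) <= t * phi x + (1 - t) * phi y.
Proof.
move=> /andP[t0 t1].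
have := phi_convex (Itv01 t0 t1) (x := x) (y := y).
by rewrite !inE => /(_ Logic.I Logic.I); rewrite !convRE.
Qed.

(** Convexity is applied at [x] seen as the barycentre of [y] and [z] with weight (z - x) / (z - y).
    The two slopes are compared after cross-multiplication. *)
Lemma convex_three_slope (y x z : R) : y < x -> x < z ->
  (phi x - phi y) * (z - x) <= (phi z - phi x) * (x - y).
Proof.
move=> yx xz; have yz : 0 < z - y by lra.
pose t := (z - x) / (z - y).
have t01 : 0 <= t <= 1.
  by rewrite /t divr_ge0 ?ler_pdivrMr//; lra.
have := convex_functionP y z t01.
have -> : t * y + (1 - t) * z = x by rewrite /t; field; rewrite gt_eqF.
have -> : t * phi y + (1 - t) * phi z = ((z - x) * phi y + (x - y) * phi z) /
  (z - y).
  by rewrite /t; field; rewrite gt_eqF.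
by rewrite ler_pdivlMr//; nra.
Qed.

(** The slope [p] is the supremum of the left difference quotients at [x]. By the three-slope
    inequality each right quotient bounds it from above, so the line lies below [phi] on both
    sides. *)
Lemma convex_support (x : R) : exists p, forall y, phi x + p * (y - x) <= phi y.
Proof.
pose S := [set (phi x - phi y) / (x - y) | y in [set y | y < x]].
have ubS z : x < z -> ubound S ((phi z - phi x) / (z - x)).
  move=> xz _ [y /= yx <-].
  by rewrite ler_pdivrMr ?subr_gt0// mulrAC ler_pdivlMr ?subr_gt0//;
    exact: convex_three_slope.
have S0 : S !=set0 by exists ((phi x - phi (x - 1)) / (x - (x - 1)));
  exists (x - 1) => //=; lra.
have supS : has_sup S by split => //; exists ((phi (x + 1) - phi x) / (x + 1 -
  x)); apply: ubS; lra.
exists (sup S) => y; have [yx|xy|->] := ltgtP y x;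
  last by rewrite subrr mulr0 addr0.
- have : (phi x - phi y) / (x - y) <= sup S by apply: ub_le_sup;
    [case: supS|exists y].
  by rewrite ler_pdivrMr ?subr_gt0//; lra.
- have : sup S <= (phi y - phi x) / (y - x) by apply: sup_le_ub => //;
    exact: ubS.
  by rewrite ler_pdivlMr ?subr_gt0//; lra.
Qed.

(** The sublevel sets of a convex function are intervals, and their complements are the preimages of
    the generating rays []c, +oo[]. *)
Lemma measurable_convex : measurable_fun setT phi.
Proof.
apply: (measurability _ (RGenOInfty.measurableE R)) => // _ [_ [c ->] <-].
rewrite setTI -[X in measurable X]setCK; apply: measurableC.
apply: is_interval_measurable => x y /= xc yc z /andP[xz zy].
move: xc yc; rewrite !in_itv/= !andbT => /negP; rewrite -leNgt => xc.
move=> /negP; rewrite -leNgt => yc; apply/negP; rewrite -leNgt.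
have [xy|yx] := ltP x y; last first.
  by have -> : z = x by apply/eqP; rewrite eq_le xz (le_trans zy).
pose t := (y - z) / (y - x).
have yx0 : 0 < y - x by lra.
have t01 : 0 <= t <= 1 by rewrite /t divr_ge0 ?ler_pdivrMr//; lra.
have := convex_functionP x y t01.
have -> : t * x + (1 - t) * y = z by rewrite /t; field; rewrite gt_eqF.
by move: t01 => /andP[t0 t1]; nra.
Qed.

Lemma convex_sub_affine (c p : R) :
  convex_function (setT : set R) (fun x => phi x - (c + p * x)).
Proof.
have H (s u v : R) : 0 <= s <= 1 ->
    phi (s * u + (1 - s) * v) - (c + p * (s * u + (1 - s) * v)) <=
    s * (phi u - (c + p * u)) + (1 - s) * (phi v - (c + p * v)).
  move=> /(convex_functionP u v) h.
  rewrite [leRHS](_ : _ = s * phi u + (1 - s) * phi v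
    - (c + p * (s * u + (1 - s) * v))); last by ring.
  by rewrite lerD2r.
move=> t x y _ _; rewrite convRE; apply: H.
by apply/andP; split.
Qed.

End convexity.

(** * Integration, the Gamma function and the exponential law *)

Section density.
Context d (T : measurableType d) (R : realType).
Local Open Scope ereal_scope.

(** The function [f] agrees almost everywhere with the Radon-Nikodym derivative of [nu], for which
    the change of variables is known. *)
Lemma ge0_integral_density (nu : {finite_measure set T -> \bar R})
    (mu : {sigma_finite_measure set T -> \bar R}) (f g : T -> \bar R) :
    mu.-integrable setT f ->
    (forall A, measurable A -> nu A = \int[mu]_(x in A) f x) ->
    measurable_fun setT g -> (forall x, 0 <= g x) ->
  \int[nu]_x g x = \int[mu]_x (g x * f x).
Proof.
move=> intf nuE mg g0.
have numu : nu `<< mu.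
  apply/null_content_dominatesP => A mA muA0; rewrite nuE//.
  by apply: null_set_integral => //; exact: measurable_funTS (measurable_int _
    intf).
have intn := Radon_Nikodym_SigmaFinite.f_integrable numu.
rewrite -(Radon_Nikodym_SigmaFinite.change_of_variables numu)//.
apply: ae_eq_integral => //.
- exact: emeasurable_funM (measurable_int _ intn).
- exact: emeasurable_funM (measurable_int _ intf).
apply: ae_eqe_mul2l; apply: integral_ae_eq => //.
- exact: measurable_int intf.
- move=> E _ mE.
  by rewrite -Radon_Nikodym_SigmaFinite.f_integral// nuE.
Qed.

Lemma ge0_integrable (m : {measure set T -> \bar R}) (f : T -> R) :
    measurable_fun setT f -> (forall w, (0 <= f w)%R) ->
    (\int[m]_w (f w)%:E < +oo)%E ->
  m.-integrable setT (EFin \o f).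
Proof.
move=> mf f0 foo; apply/integrableP; split; first exact/measurable_EFinP.
by under eq_integral => w _ do rewrite gee0_abs ?lee_fin//.
Qed.

End density.

Section scaling.
Context (R : realType).
Local Notation mu := (@lebesgue_measure R).

(** Lebesgue measure equals [c] times its image under multiplication by [c]: both agree on half-open
    intervals, which determine it. *)
Lemma ge0_integral_scaling (c : R) (g : R -> \bar R) : 0 < c ->
    measurable_fun setT g -> (forall x, (0 <= g x)%E) ->
  (\int[mu]_x g x = c%:E * \int[mu]_x g (c * x)%R)%E.
Proof.
move=> c0 mg g0.
pose mR := measurableTypeR R.
have mc : measurable_fun [set: mR] ( *%R c : mR -> mR).
  exact: measurable_funM.
have muE A : measurable A ->
    mu A = mscale (NngNum (ltW c0)) (pushforward mu ( *%R c : mR -> mR)) A.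
  apply: lebesgue_measure_unique => _ [[a b] _ <-].
  rewrite [RHS]/(c%:E * mu ( *%R c @^-1` `]a, b]))%E.
  have -> : *%R c @^-1` `]a, b] = `]a / c, b / c]%classic :> set mR.
    by apply/seteqP; split => x /=; rewrite !in_itv/= ltr_pdivrMr//
      ler_pdivlMr// mulrC.
  rewrite !lebesgue_measure_itv/= !lte_fin ltr_pM2r ?invr_gt0//.
  case: (a < b) => /=; last by rewrite mulr0.
  by rewrite -EFinD; congr EFin; field; rewrite gt_eqF.
rewrite (eq_measure_integral (mscale (NngNum (ltW c0)) (pushforward mu ( *%R c
  : mR -> mR)))) => [|A mA _]; last exact: muE.
by rewrite ge0_integral_mscale// ge0_integral_pushforward.
Qed.

End scaling.

Section exponential_law.
Context d (T : measurableType d) (R : realType) (P : probability T R).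
Local Notation mu := (@lebesgue_measure R).

Lemma ge0_integral_exponential (L : {RV P >-> R}) (g : R -> R) :
    unit_exponential L -> measurable_fun setT g -> (forall x, 0 <= g x) ->
  (\int[P]_w (g (L w))%:E
    = \int[mu]_(x in `]0%R, +oo[) (g x * expR (- x))%:E)%E.
Proof.
move=> hL mg g0.
have mg' : measurable_fun setT (EFin \o g) by exact/measurable_EFinP.
(* [L] is repackaged with values in [measurableTypeR R], so that its law and Lebesgue measure live
   on the same space. *)
pose GR := measurableTypeR R.
have mL : measurable_fun setT (L : T -> GR) by exact: (@measurable_funPT _ _ _
  _ L).
pose L' : {mfun T >-> GR} :=
  HB.pack (L : T -> GR) (isMeasurableFun.Build _ _ _ _ (L : T -> GR) mL).
transitivity (\int[distribution P L']_x (g x)%:E)%E.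
  by rewrite ge0_integral_distribution.
rewrite (@ge0_integral_density _ GR R (distribution P L') mu
  (EFin \o exponential_pdf 1) (EFin \o g))//.
- rewrite [RHS]integral_itv_obnd_cbnd; last first.
    apply/measurable_EFinP/measurable_funTS/measurable_funM => //.
    exact: measurableT_comp.
  rewrite [RHS]integral_mkcond; apply: eq_integral => x _.
  rewrite patchE/=; case: ifPn.
    by rewrite inE/= in_itv/= andbT => x0;
      rewrite exponential_pdfE// mul1r mulN1r.
  rewrite notin_setE/= in_itv/= andbT => /negP; rewrite -ltNge.
  by move=> /lt0_exponential_pdf ->; rewrite mule0.
- exact: integrable_exponential_pdf.
Qed.

End exponential_law.

Section improper.
Context (R : realType).
Local Notation mu := (@lebesgue_measure R).

(** Monotone convergence along the compact intervals, which exhaust the open half-line. It allows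
    the fundamental theorem of calculus to be used away from a singularity at 0. *)
Lemma ge0_integral_itv0y_le (f : R -> \bar R) (C : \bar R) :
    measurable_fun setT f -> (forall x, (0 <= f x)%E) ->
    (forall n, \int[mu]_(x in `[n.+1%:R^-1%R, n.+1%:R%R]) f x <= C)%E ->
  (\int[mu]_(x in `]0%R, +oo[) f x <= C)%E.
Proof.
move=> mf f0 fC.
pose A n : set (measurableTypeR R) := `[n.+1%:R^-1 : R, n.+1%:R]%classic.
have -> : `]0%R, +oo[%classic = \bigcup_n A n.
  apply/seteqP; split => [x /=|x [n _]]; rewrite /A/= !in_itv/= ?andbT.
    move=> x0; have y0 : 0 < x^-1 by rewrite invr_gt0.
    exists (Num.bound x + Num.bound x^-1)%N => //=; rewrite in_itv/=.
    apply/andP; split.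
      rewrite invf_ple ?posrE ?ltr0n// (le_trans (ltW (archi_boundP (ltW
        y0))))//.
      by rewrite ler_nat leqW// leq_addl.
    rewrite (le_trans (ltW (archi_boundP (ltW x0))))//.
    by rewrite ler_nat leqW// leq_addr.
  by move=> /andP[+ _]; apply: lt_le_trans; rewrite invr_gt0.
have ndA : nondecreasing_seq A.
  move=> m n mn; rewrite subsetEset; apply: subset_itv; rewrite bnd_simp.
    by rewrite lef_pV2 ?posrE// ler_nat ltnS.
  by rewrite ler_nat ltnS.
have /cvg_lim <- // := @ge0_nondecreasing_set_cvg_integral _ (measurableTypeR
  R) R A f mu ndA
  (fun n => measurable_itv _) (fun n => measurable_funTS mf) (fun n x _ =>
    f0 x).
apply: lime_le; last exact: nearW.
apply: ereal_nondecreasing_is_cvgn.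
exact: (@ge0_nondecreasing_set_nondecreasing_integral _ (measurableTypeR R) R A
  f mu ndA (fun n => measurable_itv _) (fun n => measurable_funTS mf)
  (fun n x _ => f0 x)).
Qed.

Lemma is_derive_FTC2 (f F : R -> R) (a b : R) : a < b ->
    (forall x, a <= x <= b -> is_derive x 1 F (f x)) ->
    (forall x, a <= x <= b -> {for x, continuous f}) ->
  (\int[mu]_(x in `[a, b]) (f x)%:E = (F b - F a)%:E)%E.
Proof.
move=> ab dF cf.
have cF x : a <= x <= b -> {for x, continuous F}.
  by move=> /dF [? _]; apply/differentiable_continuous/derivable1_diffP.
rewrite (@continuous_FTC2 _ f F)//.
- apply: continuous_in_subspaceT => x; rewrite inE/= in_itv/=; exact: cf.
- split => [x||].
  + by rewrite in_itv/= => /andP[ax xb]; have [] := dF x; rewrite ?ltW.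
  + by apply: cvg_at_right_filter; apply: cF; rewrite lexx ltW.
  + by apply: cvg_at_left_filter; apply: cF; rewrite lexx ltW.
- move=> x; rewrite in_itv/= => /andP[ax xb]; rewrite derive1E.
  by apply: derive_val; apply: dF; rewrite !ltW.
Qed.

Lemma continuous_powR (p x : R) : 0 < x -> {for x, continuous (fun y =>
  y `^ p)}.
Proof.
move=> x0; apply/differentiable_continuous/derivable1_diffP.
by have [] := is_derive1_powR p x0.
Qed.

Lemma integral_expRN_itvcy (c : R) :
  (\int[mu]_(x in `[c, +oo[) (expR (- x))%:E = (expR (- c))%:E)%E.
Proof.
have dF (x : R) : is_derive x 1 (fun y : R => - expR (- y)) (expR (- x)).
  have d1 : is_derive x 1 (fun y : R => - y) (- 1) by exact: is_deriveN.
  have := is_deriveN (@is_derive1_comp R expR (fun y =>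
    - y) x _ _ (is_derive_expR _) d1).
  by rewrite mulrN1 opprK.
rewrite (@ge0_continuous_FTC2y R (fun x => expR (- x)) (fun x =>
  - expR (- x)) c 0).
- by rewrite sub0e -EFinN opprK.
- by move=> x _; exact: expR_ge0.
- apply: continuous_subspaceT => x; apply: continuous_comp;
    last exact: continuous_expR.
  exact: continuousN.
- by rewrite -[X in _ --> X]oppr0; apply: cvgN; exact: cvgr_expR.
- by move=> x _; have [] := dF x.
- apply: cvg_at_right_filter; apply: cvgN; apply: continuous_comp;
    last exact: continuous_expR.
  exact: continuousN.
- by move=> x _; rewrite derive1E; apply: derive_val.
Qed.

End improper.

Section Gamma.
Context (R : realType).
Local Notation mu := (@lebesgue_measure R).
Implicit Types s x p : R.

(** This is the inequality x / p <= exp (x / p) raised to the power [p]. *)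
Lemma powR_le_expR p x : 0 < p -> 0 <= x -> x `^ p <= p `^ p * expR x.
Proof.
move=> p0 x0.
have xE : x = (x / p) * p by rewrite divfK// gt_eqF.
rewrite [in leRHS]xE expRM -powRM ?expR_ge0 ?(ltW p0)//.
apply: ge0_ler_powR; rewrite ?nnegrE ?mulr_ge0 ?expR_ge0 ?(ltW p0)//.
rewrite {1}xE mulrC ler_pM2l//.
by rewrite (le_trans _ (expR_ge1Dx _))// lerDr.
Qed.

(** A bounded primitive whose derivative behaves like x^(s - 1) near 0 and like x^(- s - 1) at
    infinity; it provides a single majorant for the Gamma integrand on the whole half-line. *)
Lemma is_derive_inv1DpowR s x : 0 < x ->
  is_derive x 1 (fun y => - (1 + y `^ s)^-1)
    (s * x `^ (s - 1) * (1 + x `^ s) `^ (- 2)).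
Proof.
move=> x0; have := is_derive1_powR s x0 => d1.
have n0 : 1 + x `^ s != 0 by rewrite gt_eqF// ltr_pwDl// powR_ge0.
have d2 : is_derive x 1 (fun y => 1 + y `^ s) (s * x `^ (s - 1)).
  have := is_deriveD (is_derive_cst (1 : R) x 1) d1.
  by rewrite add0r.
have := is_deriveN (@is_deriveV R (fun y => 1 + y `^ s) _ _ _ n0 d2).
by rewrite scaleNr opprK /GRing.scale/= mulrC powR_invn// addr_ge0 ?powR_ge0.
Qed.

Lemma integral_powR_expR_lty s : 0 < s ->
  (\int[mu]_(x in `]0%R, +oo[) (x `^ (s - 1) * expR (- x))%:E < +oo)%E.
Proof.
move=> s0.
have s20 : 0 < s * 2 by rewrite mulr_gt0.
(* The numerator bounds (1 + x^s)^2 exp (- x): use (1 + u)^2 <= 2 + 2 u^2 with u = x^s, then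
   [powR_le_expR] with exponent 2 s. Division by [s] offsets the factor [s] in the derivative
   [g]. *)
pose C := (2 + 2 * (s * 2) `^ (s * 2)) / s.
have C0 : 0 <= C.
  by rewrite divr_ge0 ?(ltW s0)// addr_ge0// mulr_ge0// powR_ge0.
apply: (@le_lt_trans _ _ C%:E); last exact: ltry.
have mf : measurable_fun setT (fun x : R => (x `^ (s - 1) * expR (- x))).
  by apply: measurable_funM; [exact: measurable_powR|exact: measurableT_comp].
apply: ge0_integral_itv0y_le.
- exact/measurable_EFinP.
- by move=> x; rewrite lee_fin mulr_ge0 ?powR_ge0 ?expR_ge0.
(* For index 0 the interval is the single point 1, while the fundamental theorem below requires
   distinct endpoints. *)
move=> [|n].
  rewrite invr1 set_itv1 integral_set1 lee_fin//.
have n0 : 0 < n.+2%:R^-1 :> R by rewrite invr_gt0.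
pose g x := s * x `^ (s - 1) * (1 + x `^ s) `^ (- 2).
have g0 x : 0 <= g x.
  by rewrite !mulr_ge0 ?(ltW s0) ?powR_ge0.
have mg : measurable_fun setT g.
  apply: measurable_funM.
    by apply: measurable_funM => //; exact: measurable_powR.
  apply: (measurableT_comp (measurable_powR _)).
  by apply: measurable_funD => //; exact: measurable_powR.
apply: (@le_trans _ _ (\int[mu]_(x in `[n.+2%:R^-1%R, n.+2%:R%R]) (C%:E * (g
  x)%:E)))%E.
  apply: ge0_le_integral => //.
  + by move=> x _; rewrite lee_fin mulr_ge0 ?powR_ge0 ?expR_ge0.
  + exact/measurable_EFinP/measurable_funTS.
  + by apply/measurable_EFinP/measurable_funTS; exact: measurable_funM.
  move=> x /=; rewrite in_itv/= => /andP[nx _].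
  have x0 : 0 < x by exact: lt_le_trans nx.
  have h0 : 0 < 1 + x `^ s by rewrite ltr_pwDl// powR_ge0.
  rewrite -EFinM lee_fin /g expRN powR_invn ?(ltW h0)//.
  rewrite [leRHS](_ : _ = x `^ (s - 1) * (C * s / (1 + x `^ s) ^+ 2));
    last by ring.
  rewrite ler_wpM2l ?powR_ge0// ler_pdivlMr ?exprn_gt0//
    mulrC ler_pdivrMr ?expR_gt0//.
  rewrite divfK ?gt_eqF//.
  apply: (@le_trans _ _ (2 + 2 * (x `^ (s * 2)))).
    rewrite (_ : x `^ (s * 2) = x `^ s ^+ 2); last first.
      by rewrite powRrM -[2]/(2%:R) powR_mulrn// powR_ge0.
    by have := sqr_ge0 (1 - x `^ s); lra.
  have := powR_le_expR s20 (ltW x0).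
  by have := expR_ge1Dx x; lra.
rewrite ge0_integralZl_EFin//; last 2 first.
- by move=> x _; rewrite lee_fin.
- exact/measurable_EFinP/measurable_funTS.
have dF x : n.+2%:R^-1 <= x <= n.+2%:R ->
    is_derive x 1 (fun y => - (1 + y `^ s)^-1) (g x).
  by move=> /andP[nx _]; apply: is_derive_inv1DpowR; exact: lt_le_trans nx.
have cg x : n.+2%:R^-1 <= x <= n.+2%:R -> {for x, continuous g}.
  move=> /andP[nx _]; have x0 : 0 < x by exact: lt_le_trans nx.
  apply: continuousM.
    by apply: continuousM; [exact: cst_continuous|exact: continuous_powR].
  apply: (@continuous_comp _ _ _ (fun y => 1 + y `^ s) (fun y => y `^ (- 2))).
    by apply: continuousD; [exact: cst_continuous|exact: continuous_powR].
  by apply: continuous_powR; rewrite ltr_pwDl// powR_ge0.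
rewrite (is_derive_FTC2 _ dF cg); last first.
  by rewrite (@lt_trans _ _ 1) ?invf_lt1// ltr1n.
(* The primitive takes values between -1 and 0, so its increment is at most 1. *)
rewrite -EFinM lee_fin -[leRHS]mulr1 ler_wpM2l// opprK.
have h y : 0 <= (1 + y `^ s)^-1 <= 1.
  by rewrite invr_ge0 addr_ge0 ?powR_ge0//= invf_le1 ?lerDl ?powR_ge0//
    ltr_pwDl ?powR_ge0.
by have := h n.+2%:R; have := h n.+2%:R^-1; lra.
Qed.

Lemma integral_Gamma s : 0 < s ->
  (\int[mu]_(x in `]0%R, +oo[) (x `^ (s - 1) * expR (- x))%:E = (Gamma s)%:E)%E.
Proof.
move=> s0; rewrite /Gamma /Rintegral fineK// ge0_fin_numE.
  exact: integral_powR_expR_lty.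
by apply: integral_ge0 => x _; rewrite lee_fin mulr_ge0 ?powR_ge0 ?expR_ge0.
Qed.

(** A zero integral would make the integrand vanish almost everywhere, whereas it is positive on a
    half-line of infinite measure. *)
Lemma Gamma_gt0 s : 0 < s -> 0 < Gamma s.
Proof.
move=> s0; have f0 x : (0 <= (x `^ (s - 1) * expR (- x))%:E)%E.
  by rewrite lee_fin mulr_ge0 ?powR_ge0 ?expR_ge0.
rewrite lt0r -lee_fin -integral_Gamma// integral_ge0 ?andbT//.
apply/eqP => G0; have := integral_Gamma s0; rewrite G0.
under eq_integral => x _ do rewrite -(gee0_abs (f0 x)).
move=> /(ae_eq_integral_abs _ _ _).1 -[].
- by [].
- apply/measurable_EFinP/measurable_funTS/measurable_funM.
    exact: measurable_powR.
  exact: measurableT_comp.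
move=> N [mN N0 subN].
have : (mu `]0%R, +oo[ <= mu N)%E.
  apply: le_measure; rewrite ?inE// => x; rewrite /= in_itv/= andbT => x0.
  apply: subN => /=; rewrite in_itv/= andbT => /(_ x0)/eqP.
  by rewrite eqe mulf_eq0 expR_eq0 orbF gt_eqF// powR_gt0.
by rewrite N0 lebesgue_measure_itv/= ltry addye// leye_eq.
Qed.

(** Since q / (1 + q) = 1 - 1 / (1 + q), this is 1 - r <= exp (- r) at r = q / (1 + q), inverted. It
    later bounds powers of 1 + q from below by exponentials. *)
Lemma expR_le_1D (q : R) : 0 <= q -> expR (q / (1 + q)) <= 1 + q.
Proof.
move=> q0; have q10 : 0 < 1 + q by lra.
rewrite -[leRHS]invrK -[leLHS]invrK lef_pV2 ?posrE ?invr_gt0 ?expR_gt0// -expRN.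
rewrite (le_trans _ (expR_ge1Dx _))// (_ : 1 + - (q / (1 + q)) = (1 + q)^-1)//.
by field; rewrite gt_eqF.
Qed.

End Gamma.

Section exponential_moments.
Context d (T : measurableType d) (R : realType) (P : probability T R).
Local Notation mu := (@lebesgue_measure R).
Variables (L : {RV P >-> R}) (hL : unit_exponential L).

Lemma integral_exponential_powR (s : R) : 0 < s ->
  (\int[P]_w (L w `^ (s - 1))%:E = (Gamma s)%:E)%E.
Proof.
move=> s0; rewrite (@ge0_integral_exponential _ _ _ _ L (fun x =>
  x `^ (s - 1)))//.
  exact: integral_Gamma.
by move=> x; rewrite powR_ge0.
Qed.

(** The extra exponential turns the rate 1 of the density into 1 + c; the substitution x -> (1 + c)
    x brings back the Gamma integral. *)
Lemma integral_exponential_powR_expR (s c : R) : 0 < s -> 0 <= c ->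
  (\int[P]_w (L w `^ (s - 1) * expR (- (c * L w)))%:E
    = ((1 + c) `^ (- s) * Gamma s)%:E)%E.
Proof.
move=> s0 c0; have c10 : 0 < 1 + c by rewrite ltr_pwDl.
rewrite EFinM -integral_Gamma//.
rewrite (@ge0_integral_exponential _ _ _ _ L (fun x =>
  x `^ (s - 1) * expR (- (c * x))))//; last 2 first.
- apply: measurable_funM; first exact: measurable_powR.
  by apply: measurableT_comp => //; apply: measurable_funN;
    exact: measurable_funM.
- by move=> x; rewrite mulr_ge0 ?powR_ge0 ?expR_ge0.
rewrite [in RHS]integral_mkcond/=; set f := _ \_ _.
have mf : measurable_fun setT f.
  apply/(measurable_restrictT _ _).1 => //.
  apply/measurable_EFinP/measurable_funTS/measurable_funM;
    first exact: measurable_powR.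
  exact: measurableT_comp.
rewrite (@ge0_integral_scaling R (1 + c))//; last first.
  move=> x; apply: erestrict_ge0 => y _.
  by rewrite lee_fin mulr_ge0 ?powR_ge0 ?expR_ge0.
rewrite muleA -EFinM.
have -> : (1 + c) `^ (- s) * (1 + c) = (1 + c) `^ (1 - s).
  by rewrite powRD ?(gt_eqF c10) ?implybT// powRr1 ?(ltW c10)// mulrC.
rewrite -ge0_integralZl_EFin ?powR_ge0//.
- rewrite [LHS]integral_mkcond/=; apply: eq_integral => x _.
  have xc : ((1 + c) * x \in `]0, +oo[%classic) = (x \in `]0, +oo[%classic).
    by apply/idP/idP; rewrite !inE/= !in_itv/= !andbT pmulr_rgt0.
  rewrite /f !patchE xc; case: ifPn => [|_]; last by rewrite mule0.
  rewrite inE/= in_itv/= andbT => x0.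
  rewrite -EFinM; congr EFin; rewrite powRM ?(ltW x0) ?(ltW c10)//
    !mulrA -powRD; last first.
    by rewrite (gt_eqF c10) implybT.
  rewrite (_ : 1 - s + (s - 1) = 0); last by ring.
  rewrite powRr0 mul1r -mulrA -expRD; congr (_ * expR _).
  by ring.
- by move=> x _; apply: erestrict_ge0 => y _;
    rewrite lee_fin mulr_ge0 ?powR_ge0 ?expR_ge0.
- by apply: (measurableT_comp mf); exact: measurable_funM.
Qed.

Lemma ge0_integral_exponential_norm (g : R -> R) :
    measurable_fun setT g -> (forall x, 0 <= g x) ->
  (\int[P]_w (g `|L w|)%:E = \int[P]_w (g (L w))%:E)%E.
Proof.
move=> mg g0.
rewrite (@ge0_integral_exponential _ _ _ _ L (fun x => g `|x|))//; last first.
  exact: measurableT_comp.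
rewrite (@ge0_integral_exponential _ _ _ _ L g)//.
by apply: eq_integral => x; rewrite inE/= in_itv/= andbT => x0;
  rewrite gtr0_norm.
Qed.

Lemma exponential_tail (c : R) : 0 <= c ->
  (\int[P]_w (\1_`]c, +oo[ (L w))%:E = (expR (- c))%:E)%E.
Proof.
move=> c0; rewrite (ge0_integral_exponential hL) -?integral_expRN_itvcy//.
rewrite -integral_itv_obnd_cbnd; last first.
  by apply/measurable_EFinP/measurable_funTS; exact: measurableT_comp.
rewrite integral_mkcond [RHS]integral_mkcond; apply: eq_integral => x _.
rewrite !patchE indicE.
have [cx|xc] := ltP c x.
  have xin : x \in `]c, +oo[%classic by rewrite inE/= in_itv/= cx.
  by rewrite xin mul1r ifT// inE/= in_itv/= andbT (le_lt_trans c0).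
have xin : x \in `]c, +oo[%classic = false.
  by apply/negbTE; rewrite notin_setE/= in_itv/= andbT; apply/negP;
    rewrite -leNgt.
by rewrite xin mul0r; case: ifP.
Qed.

(** The maximum with 0 accounts for negative thresholds. The closed tail reduces to the open one
    because single points are Lebesgue-null. *)
Lemma exponential_prob_ge (c : R) :
  P [set w | c <= L w] = (expR (- Num.max 0 c))%:E.
Proof.
have mL : measurable [set w | c <= L w].
  rewrite (_ : mkset _ = L @^-1` `[c, +oo[); last first.
    by apply/seteqP; split => w /=; rewrite in_itv/= andbT.
  by rewrite -[X in measurable X]setTI; exact: measurable_funPT.
rewrite -[X in P X]setIT -integral_indic//.
have m0 : 0 <= Num.max 0 c by rewrite le_max lexx.
rewrite -(exponential_tail m0).
transitivity (\int[P]_w (\1_`[c, +oo[ (L w))%:E)%E.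
  apply: eq_integral => w _; congr EFin; rewrite !indicE; congr (_%:R);
    congr nat_of_bool.
  by apply/idP/idP; rewrite !inE/= in_itv/= andbT.
rewrite (ge0_integral_exponential hL)// (ge0_integral_exponential hL)//.
rewrite integral_itv_obnd_cbnd; last first.
  by apply/measurable_EFinP/measurable_funTS/measurable_funM => //;
    exact: measurableT_comp.
rewrite [RHS]integral_itv_obnd_cbnd; last first.
  by apply/measurable_EFinP/measurable_funTS/measurable_funM => //;
    exact: measurableT_comp.
transitivity (\int[lebesgue_measure]_(x in `[(Num.max 0 c)%R, +oo[) (expR (-
  x))%:E)%E.
  rewrite integral_mkcond [RHS]integral_mkcond; apply: eq_integral => x _.
  rewrite !patchE indicE !mem_setE/= !in_itv/= !andbT ge_max.
  by case: (0 <= x) => //=; case: (c <= x); rewrite ?mul1r ?mul0r.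
rewrite -integral_itv_obnd_cbnd; last first.
  apply/measurable_EFinP/measurable_funTS; do ?[apply: measurable_funM => //].
  exact: measurableT_comp.
rewrite -integral_itv_obnd_cbnd; last first.
  apply/measurable_EFinP/measurable_funTS; do ?[apply: measurable_funM => //].
  exact: measurableT_comp.
rewrite integral_mkcond [RHS]integral_mkcond; apply: eq_integral => x _.
rewrite !patchE indicE !mem_setE/= !in_itv/= !andbT gt_max.
by case: (0 < x) => //=; case: (c < x); rewrite ?mul1r ?mul0r.
Qed.

Lemma exponential_ae_gt0 : {ae P, forall w', 0 < L w'}.
Proof.
have mS : measurable [set w' | 0 < L w'].
  rewrite (_ : mkset _ = L @^-1` `]0, +oo[); last first.
    by apply/seteqP; split => w' /=; rewrite in_itv/= andbT.
  by rewrite -[X in measurable X]setTI; exact: measurable_funPT.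
exists (~` [set w' | 0 < L w']); split => //; first exact: measurableC.
rewrite probability_setC//.
have -> : P [set w' | 0 < L w'] = 1%E.
  have := exponential_tail (lexx 0); rewrite oppr0 expR0 => <-.
  rewrite -[X in P X]setIT -integral_indic//; apply: eq_integral => w' _.
  by rewrite !indicE !mem_setE/= in_itv/= andbT.
by rewrite subee.
Qed.

End exponential_moments.

(** * Bernstein polynomials and determinacy by moments *)

Section bernstein.
Context (R : realType).
Implicit Types (f g : nat -> R) (v : R).

(* [bernstein n f v] is the expectation of [f S], [S] binomial with parameters
   [n] and [v]; the recursion conditions on the first trial. *)
Fixpoint bernstein n f v : R :=
  if n is m.+1 then v * bernstein m (f \o succn) v + (1 - v) * bernstein m f v
  else f 0%N.

Lemma bernstein_cst n (c : R) v : bernstein n (fun=> c) v = c.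
Proof. by elim: n => //= n IH; rewrite /comp IH; ring. Qed.

Lemma bernstein_lin n (c e : R) f v :
  bernstein n (fun k => c + e * f k) v = c + e * bernstein n f v.
Proof. by elim: n f => //= n IH f; rewrite /comp !IH; ring. Qed.

Lemma ler_bernstein n f g v : 0 <= v <= 1 -> (forall k, (k <= n)%N ->
  f k <= g k) ->
  bernstein n f v <= bernstein n g v.
Proof.
move=> v01; elim: n f g => [|n IH] f g fg /=; first exact: fg.
by apply: lerD; apply: ler_wpM2l; try lra; apply: IH => k kn; apply: fg => //;
  exact: leqW.
Qed.

(** The centre [c] is arbitrary so that the induction closes: a successful first trial replaces [c]
    by c - 1. At c = n v this is the binomial variance. *)
Lemma bernstein_sqr n (c : R) v :
  bernstein n (fun k => (k%:R - c) ^+ 2) v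
    = n%:R * v * (1 - v) + (n%:R * v - c) ^+ 2.
Proof.
elim: n c => [|n IH] c /=; first by ring.
have -> : (fun k => (k%:R - c) ^+ 2) \o succn = fun k => (k%:R - (c - 1)) ^+ 2.
  by apply/funext => k /=; rewrite -natr1; ring.
by rewrite !IH -natr1; ring.
Qed.

Lemma bernstein_bounded n f v (C : R) : 0 <= v <= 1 ->
  (forall k, `|f k| <= C) -> `|bernstein n f v| <= C.
Proof.
move=> v01 fC; rewrite ler_norml.
have fCE k : - C <= f k /\ f k <= C by have := fC k; rewrite ler_norml => /andP.
have := @ler_bernstein n (fun=> - C) f v v01 (fun k _ => (fCE k).1).
have := @ler_bernstein n f (fun=> C) v v01 (fun k _ => (fCE k).2).
by rewrite !bernstein_cst => -> ->.
Qed.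

(** Chebyshev's argument: continuity controls the values within [delta] of [v], the variance
    controls the others. *)
Lemma bernstein_dist (h : R -> R) n v (C delta e : R) : 0 <= v <= 1 ->
  0 < delta ->
    (forall x, `|h x| <= C) ->
    (forall x, `|x - v| < delta -> `|h x - h v| <= e) ->
  `|bernstein n.+1 (fun k => h (k%:R / n.+1%:R)) v - h v|
    <= e + 2 * C / delta ^+ 2 / n.+1%:R.
Proof.
move=> v01 d0 hC hd.
have C0 : 0 <= C by exact: le_trans (hC 0).
have n0 : 0 < n.+1%:R :> R by [].
have e0 : 0 <= e by apply: le_trans (hd v _); rewrite ?subrr ?normr0.
pose K := 2 * C / delta ^+ 2 / n.+1%:R ^+ 2.
have K0 : 0 <= K by rewrite !mulr_ge0 ?invr_ge0 ?exprn_ge0// ltW.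
have dist k : `|h (k%:R / n.+1%:R) - h v| <= e + K * (k%:R - n.+1%:R * v) ^+ 2.
  have [near|far] := ltP `|k%:R / n.+1%:R - v| delta.
    by rewrite (le_trans (hd _ near))// lerDl mulr_ge0// sqr_ge0.
  (* Far from [v] the deviation is at most 2 C, and the ratio (k / (n + 1) - v)^2 / delta^2 is at
     least 1. *)
  have : delta ^+ 2 <= (k%:R / n.+1%:R - v) ^+ 2.
    by rewrite -[leRHS]real_normK ?num_real// lerXn2r ?nnegrE ?(ltW d0).
  have -> : K * (k%:R - n.+1%:R * v) ^+ 2 =
      2 * C / delta ^+ 2 * (k%:R / n.+1%:R - v) ^+ 2.
    by rewrite /K; field; rewrite ?gt_eqF// ltr_pwDl.
  move=> far2; rewrite -[leLHS]add0r lerD//.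
  apply: (@le_trans _ _ (2 * C)).
    have := ler_normB (h (k%:R / n.+1%:R)) (h v).
    by have := hC (k%:R / n.+1%:R); have := hC v; lra.
  rewrite mulrAC ler_pdivlMr ?exprn_gt0// ler_wpM2l// mulr_ge0//.
pose B := fun k => e + K * (k%:R - n.+1%:R * v) ^+ 2.
have BE : bernstein n.+1 B v <= e + 2 * C / delta ^+ 2 / n.+1%:R.
  rewrite /B bernstein_lin bernstein_sqr subrr expr0n/= addr0 lerD2l.
  have -> : K * (n.+1%:R * v * (1 - v)) = 2 * C / delta ^+ 2 / n.+1%:R * (v *
    (1 - v)).
    by rewrite /K; field; rewrite ?gt_eqF// ltr_pwDl.
  rewrite -[leRHS]mulr1 ler_wpM2l//; last by nra.
  by rewrite !mulr_ge0 ?invr_ge0 ?exprn_ge0// ltW.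
have -> : bernstein n.+1 (fun k => h (k%:R / n.+1%:R)) v - h v =
    bernstein n.+1 (fun k => - h v + 1 * h (k%:R / n.+1%:R)) v.
  by rewrite bernstein_lin mul1r addrC.
rewrite (le_trans _ BE)// ler_norml.
(* With the sign moved inside by linearity, both halves of the absolute value bound follow from
   monotonicity of [bernstein]. *)
have -> : - bernstein n.+1 B v = bernstein n.+1 (fun k => 0 + -1 * B k) v.
  by rewrite [RHS]bernstein_lin add0r mulN1r.
by apply/andP; split; apply: ler_bernstein => // k _; have := dist k;
  rewrite ler_norml /B => /andP[]; lra.
Qed.

Lemma cvg_bernstein (h : R -> R) v (C : R) : 0 <= v <= 1 ->
    (forall x, `|h x| <= C) -> {for v, continuous h} ->
  bernstein n.+1 (fun k => h (k%:R / n.+1%:R)) v @[n --> \oo] --> h v.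
Proof.
move=> v01 hC ch; apply/cvgrPdist_le => e e0.
have e20 : 0 < e / 2 by rewrite divr_gt0.
have /cvgrPdist_le/(_ _ e20)[delta/= d0 hd] := ch.
have C0 : 0 <= C by exact: le_trans (hC 0).
pose K := 2 * C / delta ^+ 2.
have K0 : 0 <= K by rewrite !mulr_ge0 ?invr_ge0 ?exprn_ge0// ltW.
exists (Num.bound (K / (e / 2))) => // n /= Nn; rewrite distrC.
rewrite (le_trans (bernstein_dist n v01 d0 hC (e := e / 2) _))//.
  by move=> x xv; rewrite distrC; apply: hd => /=; rewrite distrC.
rewrite [leRHS]splitr lerD2l -/K ler_pdivrMr// mulrC -ler_pdivrMr//.
rewrite (le_trans (ltW (archi_boundP _)))//; first by rewrite divr_ge0// ltW.
by rewrite ler_nat leqW.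
Qed.

End bernstein.

Section moment_determinacy.
Context d1 (T1 : measurableType d1) d2 (T2 : measurableType d2) (R : realType).
Variables (m1 : {measure set T1 -> \bar R}) (m2 : {measure set T2 -> \bar R}).
Variables (w1 V1 : T1 -> R) (w2 V2 : T2 -> R).
Hypotheses (iw1 : m1.-integrable setT (EFin \o w1))
  (iw2 : m2.-integrable setT (EFin \o w2)).
Hypotheses (w1_ge0 : forall x, 0 <= w1 x) (w2_ge0 : forall x, 0 <= w2 x).
Hypotheses (mV1 : measurable_fun setT V1) (mV2 : measurable_fun setT V2).
Hypotheses (V1_01 : forall x, 0 <= V1 x <= 1)
  (V2_01 : forall x, 0 <= V2 x <= 1).
Hypothesis moments : forall j : nat,
  (\int[m1]_x (w1 x * V1 x ^+ j)%:E = \int[m2]_x (w2 x * V2 x ^+ j)%:E)%E.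

Lemma measurable_bernstein n f : measurable_fun setT (@bernstein R n f).
Proof.
elim: n f => [|n IH] f /=; first exact: measurable_cst.
apply: measurable_funD; apply: measurable_funM => //.
exact: measurable_funB.
Qed.

Lemma integrable_weighted d (T : measurableType d) (m : {measure set T ->
  \bar R})
    (w u : T -> R) (C : R) : m.-integrable setT (EFin \o w) ->
    measurable_fun setT u -> (forall x, `|u x| <= C) ->
  m.-integrable setT (fun x => (w x * u x)%:E).
Proof.
move=> iw mu uC.
have mw : measurable_fun setT w by exact/measurable_EFinP/(measurable_int _ iw).
apply: (@le_integrable _ _ _ m setT measurableT _ (fun x =>
  C%:E * (EFin \o w) x)%E).
- exact/measurable_EFinP/measurable_funM.
- move=> x _ /=; rewrite lee_fin !normrM mulrC ler_wpM2r//.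
  by rewrite (le_trans (uC x))// ler_norm.
- exact: integrableZl.
Qed.

Let bound_expr (v : R) j : 0 <= v <= 1 -> `|v ^+ j| <= 1.
Proof. by move=> /andP[v0 v1]; rewrite ger0_norm ?exprn_ge0// exprn_ile1. Qed.

(** The additional power [j] makes the induction on the degree work: expanding (1 - V) B as B - V B
    leaves Bernstein polynomials of smaller degree, multiplied by V^j or V^(j + 1). *)
Lemma integral_bernstein n (f : nat -> R) (C : R) j : (forall k, `|f k| <= C) ->
  (\int[m1]_x (w1 x * (V1 x ^+ j * bernstein n f (V1 x)))%:E
    = \int[m2]_x (w2 x * (V2 x ^+ j * bernstein n f (V2 x)))%:E)%E.
Proof.
elim: n f j => [|n IH] f j fC /=.
  under eq_integral do rewrite mulrA mulrC EFinM.
  under [RHS]eq_integral do rewrite mulrA mulrC EFinM.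
  rewrite !integralZl//; last 2 first.
  - apply: (@integrable_weighted _ _ _ _ _ 1) => //;
      first exact: measurable_funX.
    by move=> x; exact: bound_expr.
  - apply: (@integrable_weighted _ _ _ _ _ 1) => //;
      first exact: measurable_funX.
    by move=> x; exact: bound_expr.
  by rewrite moments.
have split d (T : measurableType d) (m : {measure set T -> \bar R}) (w V : T ->
  R) :
    m.-integrable setT (EFin \o w) -> measurable_fun setT V ->
    (forall x, 0 <= V x <= 1) ->
  (\int[m]_x (w x * (V x ^+ j * (V x * bernstein n (f \o succn) (V x)
       + (1 - V x) * bernstein n f (V x))))%:E
   = \int[m]_x (w x * (V x ^+ j.+1 * bernstein n (f \o succn) (V x)))%:E
     + (\int[m]_x (w x * (V x ^+ j * bernstein n f (V x)))%:E
     - \int[m]_x (w x * (V x ^+ j.+1 * bernstein n f (V x)))%:E))%E.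
  move=> iw mV V01.
  have fSC k : `|(f \o succn) k| <= C by exact: fC.
  have int i g : (forall k, `|g k| <= C) ->
      m.-integrable setT (fun x => (w x * (V x ^+ i * bernstein n g (V x)))%:E).
    move=> gC; apply: (@integrable_weighted _ _ _ _ _ C) => //.
      apply: measurable_funM; first exact: measurable_funX.
      exact: measurableT_comp (measurable_bernstein _ _) _.
    move=> x; rewrite normrM -[leRHS]mul1r ler_pM//; first exact: bound_expr.
    exact: bernstein_bounded.
  rewrite -integralB//; [|exact: int|exact: int].
  rewrite -integralD//; [|exact: int|by apply: integrableB => //; exact: int].
  by apply: eq_integral => x _; rewrite -EFinB -EFinD; congr EFin;
    rewrite exprS; ring.
by rewrite !split// IH ?IH// => k; exact: fC.
Qed.

(** The Bernstein polynomials of [h] converge pointwise on [0, 1] and stay bounded by [C], so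
    dominated convergence with majorant C w carries the equality from polynomials to [h]. *)
Lemma integral_continuous_moments (h : R -> R) (C : R) :
    continuous h -> (forall x, `|h x| <= C) ->
  (\int[m1]_x (w1 x * h (V1 x))%:E = \int[m2]_x (w2 x * h (V2 x))%:E)%E.
Proof.
move=> ch hC.
pose B n v := bernstein n.+1 (fun k => h (k%:R / n.+1%:R)) v.
have cvgB d (T : measurableType d) (m : {measure set T -> \bar R}) (w V : T ->
  R) :
    m.-integrable setT (EFin \o w) -> (forall x, 0 <= w x) ->
      measurable_fun setT V ->
    (forall x, 0 <= V x <= 1) ->
  (\int[m]_x (w x * B n (V x))%:E)%E @[n --> \oo] -->
    (\int[m]_x (w x * h (V x))%:E)%E.
  move=> iw w0 mV V01.
  have mw : measurable_fun setT w by exact/measurable_EFinP/(measurable_int _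
    iw).
  have [] // := @dominated_convergence _ _ _ m setT measurableT
    (fun n x => (w x * B n (V x))%:E) (fun x => (w x * h (V x))%:E)
    (fun x => (C%:E * (EFin \o w) x)%E).
  - move=> n; apply/measurable_EFinP/measurable_funM => //.
    exact: measurableT_comp (measurable_bernstein _ _) _.
  - apply/measurable_EFinP/measurable_funM => //; apply: measurableT_comp => //.
    exact: continuous_measurable_fun.
  - apply: aeW => x _; apply: cvg_EFin; first exact: nearW.
    by apply: cvgMr; apply: (cvg_bernstein (V01 x) hC); exact: ch.
  - exact: integrableZl.
  - apply: aeW => x n _; rewrite -EFinM lee_fin normrM (ger0_norm (w0 x)) mulrC.
    by rewrite ler_wpM2r//; apply: bernstein_bounded.
have := cvgB _ _ m1 w1 V1 iw1 w1_ge0 mV1 V1_01.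
have -> : (fun n => \int[m1]_x (w1 x * B n (V1 x))%:E)%E =
    (fun n => \int[m2]_x (w2 x * B n (V2 x))%:E)%E.
  apply/funext => n.
  transitivity (\int[m1]_x (w1 x * (V1 x ^+ 0 * B n (V1 x)))%:E)%E.
    by apply: eq_integral => x _; rewrite expr0 mul1r.
  rewrite (integral_bernstein _ _ (C := C))//.
  by apply: eq_integral => x _; rewrite expr0 mul1r.
by move=> c1; exact: cvg_unique c1 (cvgB _ _ m2 w2 V2 iw2 w2_ge0 mV2 V2_01).
Qed.

End moment_determinacy.

(** * Positive stable variables *)

Section difference_quotient.
Context (R : realType).

Lemma cvg_difference_quotient (F : R -> R) (x D : R) : is_derive x 1 F D ->
  n.+1%:R * (F (x + n.+1%:R^-1) - F x) @[n --> \oo] --> D.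
Proof.
move=> [dF FD].
(* The derivative is a limit over punctured neighbourhoods of 0, so the steps have to be nonzero. *)
have h0 : (n.+1%:R^-1 : R) @[n --> \oo] --> (0 : R)^'.
  move=> A nA; have [N _ NA] := @cvg_harmonic R _ nA.
  by exists N => // n Nn; apply: NA => //=; rewrite invr_eq0.
have := cvg_comp _ _ h0 dF; rewrite -/('D_1 F x) FD.
apply: cvg_trans; apply: near_eq_cvg; apply: nearW => n /=.
by rewrite invrK /GRing.scale/= mulr1 [in LHS](addrC _ x).
Qed.

End difference_quotient.

Section cutoff.
Context (R : realType).

(** Moment determinacy reaches continuous functions of v = exp (- z) only. The indicator of [t, u]
    divided by z is therefore replaced by a continuous function that is exact on [t, u] and vanishes
    outside [t0, u0]; the factor exp x compensates the weight exp (- z). *)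
Lemma exists_cutoff (t0 t u u0 : R) : 0 < t0 -> t0 < t -> t < u -> u < u0 ->
  exists h : R -> R, [/\ continuous h, exists C, forall v, `|h v| <= C,
    forall v, 0 <= h v,
    forall z : R, z * expR (- z) * h (expR (- z)) <= (\1_`[t0, u0] z : R) &
    forall x, t <= x <= u -> h (expR (- x)) = expR x / x].
Proof.
move=> t00 t0t tu uu0.
pose v1 := expR (- u0); pose v2 := expR (- u).
pose v3 := expR (- t); pose v4 := expR (- t0).
have v10 : 0 < v1 by exact: expR_gt0.
have v12 : v1 < v2 by rewrite ltr_expR ltrN2.
have v23 : v2 < v3 by rewrite ltr_expR ltrN2.
have v34 : v3 < v4 by rewrite ltr_expR ltrN2.
have v41 : v4 < 1 by rewrite expR_lt1 oppr_lt0.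
(* [k], in the variable [v = expR (- x)], is a trapezoid equal to 1 on the image
   of [[t, u]] and vanishing outside that of [[t0, u0]]; clipping [v] to the
   latter by [c] keeps the quotient [h] continuous. *)
pose k v : R := Num.min 1 (Num.max 0 (Num.min ((v - v1) / (v2 - v1)) ((v4 - v)
  / (v4 - v3)))).
pose c v : R := Num.max v1 (Num.min v v4).
have c_bnd v : v1 <= c v <= v4.
  by rewrite /c le_max lexx ge_max ge_min lexx orbT andbT/=; lra.
have c0 v : 0 < c v by have := c_bnd v; lra.
have lnc v : t0 <= - ln (c v).
  by rewrite lerNr -(expRK (- t0)) ler_ln ?posrE ?expR_gt0//;
    have /andP[] := c_bnd v.
have lnc0 v : 0 < - ln (c v) by exact: lt_le_trans (lnc v).
have k0 v : 0 <= k v by rewrite /k le_min ler01 le_max lexx.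
have k1 v : k v <= 1 by rewrite /k ge_min lexx.
pose h v := k v / (c v * - ln (c v)).
have h0 v : 0 <= h v by rewrite /h divr_ge0// mulr_ge0// ltW.
exists h; split => //.
- move=> v; apply: continuousM.
    apply: continuous_min; first exact: cst_continuous.
    apply: continuous_max; first exact: cst_continuous.
    apply: continuous_min; apply: continuousM; try exact: cst_continuous.
      by apply: continuousB; [exact: cvg_id|exact: cst_continuous].
    by apply: continuousB; [exact: cst_continuous|exact: cvg_id].
  have cc : {for v, continuous c}.
    apply: continuous_max; first exact: cst_continuous.
    by apply: continuous_min; [exact: cvg_id|exact: cst_continuous].
  apply: continuousV; first by rewrite gt_eqF// mulr_gt0.
  apply: continuousM => //; apply: continuousN.
  by apply: continuous_comp => //; apply: continuous_ln.
(* The numerator is at most 1, the clipped variable at least [v1], and minus its logarithm at least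
   [t0]. *)
- exists (v1 * t0)^-1 => v; rewrite ger0_norm//.
  rewrite -[leRHS]mul1r ler_pM ?invr_ge0 ?mulr_ge0 ?(ltW (c0 v)) ?(ltW (lnc0
    v))//.
  rewrite lef_pV2 ?posrE ?mulr_gt0//.
  by rewrite ler_pM ?(ltW v10) ?(ltW t00)//; have /andP[] := c_bnd v.
- move=> z; rewrite indicE mem_setE/= in_itv/=.
  case: (boolP (_ && _)) => /= zin.
    have cz : c (expR (- z)) = expR (- z).
      rewrite /c (min_idPl _) ?(max_idPr _)// ?ler_expR; lra.
    rewrite /h cz expRK opprK [leLHS](_ : _ = k (expR (- z)))//.
    have z0 : 0 < z by lra.
    by rewrite mulrCA (mulrC z) divff ?mulr1// gt_eqF// mulr_gt0 ?expR_gt0.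
  rewrite (_ : h _ = 0) ?mulr0//.
  rewrite /h (_ : k _ = 0) ?mul0r// /k.
  set m := Num.min (_ / _) _.
  have m0 : m <= 0.
    have : (z < t0) || (u0 < z) by rewrite !ltNge; lra.
    rewrite /m ge_min => /orP[z1|z1]; apply/orP; [right|left].
      by rewrite ler_pdivrMr ?subr_gt0// mul0r subr_le0 ler_expR; lra.
    by rewrite ler_pdivrMr ?subr_gt0// mul0r subr_le0 ler_expR; lra.
  by rewrite (max_idPl m0) (min_idPr _).
- move=> x /andP[tx xu].
  have cx : c (expR (- x)) = expR (- x).
    rewrite /c (min_idPl _) ?(max_idPr _)// ?ler_expR; lra.
  rewrite /h cx expRK opprK (_ : k _ = 1).
    by rewrite mul1r invfM expRN invrK.
  rewrite /k (min_idPl _)// le_max le_min !ler_pdivlMr ?subr_gt0//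
    !mul1r !lerD2r.
  by rewrite lerD2l lerN2 !ler_expR !lerN2 tx xu orbT.
Qed.

End cutoff.

Section stable.
Context d (T : measurableType d) (R : realType) (P : probability T R).
Variables (a : R) (ha : 0 < a < 1) (Z : T -> R).
Hypotheses (mZ : measurable_fun setT Z) (Z_gt0 : forall w, 0 < Z w).
Hypothesis laplaceZ : forall l, 0 <= l ->
  (\int[P]_w (expR (- (l * Z w)))%:E = (expR (- (l `^ a)))%:E)%E.

Let measurable_expRZ l : measurable_fun setT (fun w => expR (- (l * Z w))).
Proof.
by apply: measurableT_comp => //; apply: measurable_funN;
  exact: measurable_funM.
Qed.

(** The Laplace transform is differentiated at [l] under the expectation, as a limit of difference
    quotients with steps 1 / (n + 1). *)
Lemma stable_tilted_mean (l : R) : 0 < l ->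
  (\int[P]_w (Z w * expR (- (l * Z w)))%:E
    = (a * l `^ (a - 1) * expR (- (l `^ a)))%:E)%E.
Proof.
move=> l0.
pose f n w := n.+1%:R * (expR (- (l * Z w)) - expR (- ((l + n.+1%:R^-1) * Z
  w))).
have n0 n : 0 < n.+1%:R :> R by [].
have intE (m : R) : 0 <= m -> P.-integrable setT (fun w =>
  (expR (- (m * Z w)))%:E).
  move=> m0; apply/integrableP; split; first exact/measurable_EFinP.
  under eq_integral => w _ do rewrite gee0_abs ?lee_fin ?expR_ge0//.
  by rewrite laplaceZ// ltry.
have ln0 n : 0 <= l + n.+1%:R^-1 by rewrite addr_ge0 ?ltW// invr_gt0.
have intf n : (\int[P]_w (f n w)%:E =
    (n.+1%:R * (expR (- (l `^ a)) - expR (- ((l + n.+1%:R^-1) `^ a))))%:E)%E.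
  rewrite /f; under eq_integral do rewrite EFinM.
  rewrite integralZl//; last first.
    under eq_fun do rewrite EFinB.
    by apply: integrableB => //; apply: intE => //; exact: ltW.
  under eq_integral do rewrite EFinB.
  by rewrite integralB//; [rewrite !laplaceZ ?(ltW l0)//|apply: intE;
    exact: ltW|exact: intE].
have mf n : measurable_fun setT (f n).
  by apply: measurable_funM => //; apply: measurable_funB.
have cf w : f n w @[n --> \oo] --> Z w * expR (- (l * Z w)).
  have dE : is_derive l 1 (fun m => - expR (- (m * Z w))) (Z w * expR (- (l * Z
    w))).
    have d1 : is_derive l 1 (fun m => - (m * Z w)) (- Z w).
      by apply: is_derive_eq; rewrite scaler0 add0r /GRing.scale/= mulr1.
    have := is_deriveN (@is_derive1_comp R expR (fun m =>
      - (m * Z w)) l _ _ (is_derive_expR _) d1).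
    by rewrite mulrN opprK mulrC.
  have := cvg_difference_quotient dE; apply: cvg_trans.
  by apply: near_eq_cvg; apply: nearW => n; rewrite /f opprK addrC.
(* With z = [Z w]: (n + 1) (1 - exp (- z / (n + 1))) <= z, then z exp (- l z) <= 1 / l. The majorant
   is constant, so no moment of [Z] is involved. *)
have bf n w : `|f n w| <= l^-1.
  have lZ : expR (- ((l + n.+1%:R^-1) * Z w)) = expR (- (l * Z w)) * expR (- (Z
    w / n.+1%:R)).
    by rewrite -expRD; congr expR; ring.
  have fE : f n w = n.+1%:R * (1 - expR (- (Z w / n.+1%:R))) * expR (- (l * Z
    w)).
    by rewrite /f lZ; ring.
  have e1 : 0 <= 1 - expR (- (Z w / n.+1%:R)).
    by rewrite subr_ge0 expR_le1 oppr_le0 divr_ge0 ?(ltW (Z_gt0 w)).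
  rewrite ger0_norm ?fE ?mulr_ge0 ?expR_ge0//.
  apply: (@le_trans _ _ (Z w * expR (- (l * Z w)))).
    rewrite ler_wpM2r ?expR_ge0// mulrC -ler_pdivlMr//.
    by have := expR_ge1Dx (- (Z w / n.+1%:R)); set q := _ / _; lra.
  rewrite expRN ler_pdivrMr ?expR_gt0// mulrC ler_pdivlMr// mulrC.
  by have := expR_ge1Dx (l * Z w); lra.
have [] // := @dominated_convergence _ _ _ P setT measurableT
  (fun n w => (f n w)%:E) (fun w => (Z w * expR (- (l * Z w)))%:E) (fun=>
    l^-1%:E).
- by move=> n; apply/measurable_EFinP.
- by apply/measurable_EFinP/measurable_funM.
- by apply: aeW => w _; apply: cvg_EFin; [exact: nearW|exact: cf].
- exact: finite_measure_integrable_cst.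
- by apply: aeW => w n _; rewrite lee_fin.
move=> _ _ c1; apply: (cvg_unique _ c1) => //.
rewrite (_ : [sequence _]_n = (fun n => (n.+1%:R * (expR (- (l `^ a))
    - expR (- ((l + n.+1%:R^-1) `^ a))))%:E)); last by apply/funext => n;
        exact: intf.
apply: cvg_EFin; first exact: nearW.
have dE : is_derive l 1 (fun m => - expR (- (m `^ a))) (a * l `^ (a - 1) * expR
  (- (l `^ a))).
  have d1 := is_deriveN (is_derive1_powR a l0).
  have := is_deriveN (@is_derive1_comp R expR (fun m =>
    - (m `^ a)) l _ _ (is_derive_expR _) d1).
  by rewrite mulrN opprK mulrC.
have := cvg_difference_quotient dE; apply: cvg_trans.
by apply: near_eq_cvg; apply: nearW => n; rewrite opprK addrC.
Qed.

Context d' (T' : measurableType d') (P' : probability T' R).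
Variables (L : {RV P' >-> R}) (hL : unit_exponential L).

Let Gamma1 := Gamma (1 - a).

Let Gamma1_gt0 : 0 < Gamma1.
Proof. by apply: Gamma_gt0; move: ha; lra. Qed.

Let a_gt0 : 0 < a. Proof. by case/andP: ha. Qed.

(* Size-biasing the infinitely divisible variable [Z] adds an independent jump
   drawn from its Levy measure [a / Gamma (1 - a) * s `^ (- a - 1) ds], itself
   size-biased.  The factor [expR (- s)] that makes this jump measure finite is
   the density of [L]; the absolute value is there because [L] is positive only
   almost surely. *)
Lemma stable_size_bias (h : R -> R) (C : R) : continuous h ->
    (forall v, `|h v| <= C) -> (forall v, 0 <= h v) ->
  (\int[P]_w (Z w * expR (- Z w) * h (expR (- Z w)))%:E
    = \int[P]_w \int[P']_w'
        (a / Gamma1 * expR (- Z w) * `|L w'| `^ (- a)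
          * h (expR (- (Z w + `|L w'|))))%:E)%E.
Proof.
move=> ch hC h0.
have c0 : 0 <= a / Gamma1 by rewrite divr_ge0 ?ltW.
pose w2 (x : T * T') := a / Gamma1 * expR (- Z x.1) * `|L x.2| `^ (- a).
pose V2 (x : T * T') := expR (- (Z x.1 + `|L x.2|)).
have w20 x : 0 <= w2 x.
  by rewrite mulr_ge0 ?powR_ge0// mulr_ge0// expR_ge0.
have V20 x : 0 <= V2 x by exact: expR_ge0.
have mw2 : measurable_fun setT w2.
  apply: measurable_funM.
    apply: measurable_funM => //; apply: measurableT_comp => //.
    by apply: measurable_funN; exact: measurableT_comp.
  apply: (measurableT_comp (measurable_powR _)).
  by apply: measurableT_comp => //; exact: measurableT_comp.
have mV2 : measurable_fun setT V2.
  apply: measurableT_comp => //; apply: measurable_funN; apply: measurable_funD.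
    exact: measurableT_comp.
  by apply: measurableT_comp => //; exact: measurableT_comp.
(* Integrating out [L] leaves a Gamma integral of rate 1 + j and the Laplace transform of [Z] at 1 +
   j. The result is the tilted mean of [Z] at l = 1 + j, which is the moment [moments1] of the other
   side. *)
have moments2 j : (\int[P \x P']_x (w2 x * V2 x ^+ j)%:E =
    (a * (1 + j%:R) `^ (a - 1) * expR (- ((1 + j%:R) `^ a)))%:E)%E.
  rewrite fubini_tonelli1//; last 2 first.
  - by apply/measurable_EFinP/measurable_funM => //; exact: measurable_funX.
  - by move=> x; rewrite lee_fin mulr_ge0// exprn_ge0.
  transitivity (\int[P]_w ((a / Gamma1 * ((1 + j%:R) `^ (- (1 - a)) *
    Gamma1))%:E *
      (expR (- ((1 + j%:R) * Z w)))%:E))%E.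
    apply: eq_integral => w _; rewrite /fubini_F/=.
    transitivity (\int[P']_w' ((a / Gamma1 * expR (- ((1 + j%:R) * Z w)))%:E *
        (`|L w'| `^ (1 - a - 1) * expR (- (j%:R * `|L w'|)))%:E))%E.
      apply: eq_integral => w' _; rewrite -EFinM; congr EFin.
      rewrite /w2 /V2/= -expRM_natl (_ : 1 - a - 1 = - a); last by ring.
      rewrite (_ : - ((1 + j%:R) * Z w) = - Z w + - (j%:R * Z w)); last by ring.
      rewrite (_ : j%:R * - (Z w + `|L w'|) = - (j%:R * Z w) + - (j%:R * `|L
        w'|)); last by ring.
      by rewrite !expRD; ring.
    pose g (x : R) := x `^ (1 - a - 1) * expR (- (j%:R * x)).
    have mg : measurable_fun setT g.
      apply: measurable_funM; first exact: measurable_powR.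
      by apply: measurableT_comp => //; apply: measurable_funN;
        exact: measurable_funM.
    have g0 x : 0 <= g x by rewrite mulr_ge0 ?powR_ge0 ?expR_ge0.
    rewrite ge0_integralZl_EFin//; last 2 first.
    - apply/measurable_EFinP; apply: (measurableT_comp mg).
      exact: measurableT_comp.
    - by rewrite mulr_ge0 ?expR_ge0.
    rewrite (ge0_integral_exponential_norm hL mg g0).
    rewrite integral_exponential_powR_expR//; last by move: ha; lra.
    by rewrite -!EFinM; congr EFin; rewrite -/Gamma1; ring.
  rewrite ge0_integralZl_EFin//; last 2 first.
  - exact/measurable_EFinP.
  - by rewrite !mulr_ge0 ?powR_ge0 ?invr_ge0 ?ltW.
  rewrite laplaceZ// -EFinM opprB; congr EFin.
  by field; rewrite gt_eqF.
have moments1 j : (\int[P]_w (Z w * expR (- Z w) * expR (- Z w) ^+ j)%:E =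
    (a * (1 + j%:R) `^ (a - 1) * expR (- ((1 + j%:R) `^ a)))%:E)%E.
  rewrite -stable_tilted_mean ?ltr_pwDl//.
  apply: eq_integral => w _; congr EFin.
  by rewrite -expRM_natl -mulrA -expRD; congr (_ * expR _); ring.
have iw1 : P.-integrable setT (EFin \o (fun w => Z w * expR (- Z w))).
  apply/integrableP; split; first by apply/measurable_EFinP/measurable_funM =>
    //; apply: measurableT_comp => //; exact: measurable_funN.
  under eq_integral => w _ do rewrite gee0_abs ?lee_fin ?mulr_ge0 ?expR_ge0
    ?(ltW (Z_gt0 w))//.
  rewrite [ltLHS](_ : _ = \int[P]_w (Z w * expR (- Z w) * expR (- Z w) ^+
    0)%:E)%E.
    by rewrite moments1 ltry.
  by apply: eq_integral => w _; rewrite expr0 mulr1.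
have iw2 : ((P \x P')%E).-integrable setT (EFin \o w2).
  apply/integrableP; split; first exact/measurable_EFinP.
  under eq_integral => w _ do rewrite gee0_abs ?lee_fin//.
  rewrite [ltLHS](_ : _ = \int[P \x P']_x (w2 x * V2 x ^+ 0)%:E)%E.
    by rewrite moments2 ltry.
  by apply: eq_integral => w _; rewrite expr0 mulr1.
rewrite (@integral_continuous_moments _ T _ (T * T')%type R P (P \x P')%E
  (fun w => Z w * expR (- Z w)) (fun w =>
    expR (- Z w)) w2 V2 iw1 iw2 _ _ _ _ _ _ _ h C)//.
- rewrite fubini_tonelli1//.
    apply/measurable_EFinP/measurable_funM => //; apply: measurableT_comp => //.
    exact: continuous_measurable_fun.
  by move=> x; rewrite lee_fin mulr_ge0.
- by move=> w; rewrite mulr_ge0 ?expR_ge0// ltW.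
- by apply: measurableT_comp => //; exact: measurable_funN.
- by move=> w; rewrite expR_ge0 expR_le1 oppr_le0 ltW.
- by move=> x; rewrite V20 expR_le1 oppr_le0 addr_ge0// ltW.
- by move=> j; rewrite moments1 moments2.
Qed.

(** The cutoff is inserted in the size-biasing identity. Its left side is at most the probability of
    [t0, u0]. On the right only Z < t0 is kept; there the jump s satisfies s <= Z + s, so s^(- a) >=
    (Z + s)^(- a), and the integral of a (Z + s)^(- a - 1) over t <= Z + s <= u is explicit. *)
Lemma stable_prob_increment (t0 t u u0 : R) : 0 < t0 -> t0 < t -> t < u ->
  u < u0 ->
  (P [set w | (Z w < t0)%R] * ((t `^ (- a) - u `^ (- a)) / Gamma1)%:E
    <= P [set w | (t0 <= Z w <= u0)%R])%E.
Proof.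
move=> t00 t0t tu uu0.
have [h [ch [C hC] h0 hup hlow]] := exists_cutoff t00 t0t tu uu0.
have mlt : measurable [set w | Z w < t0].
  rewrite (_ : mkset _ = Z @^-1` `]-oo, t0[); last first.
    by apply/seteqP; split => w /=; rewrite in_itv.
  by rewrite -[X in measurable X]setTI; exact: mZ.
have itvE : [set w | t0 <= Z w <= u0] = Z @^-1` `[t0, u0].
  by apply/seteqP; split => w /=; rewrite in_itv.
have mitv : measurable [set w | t0 <= Z w <= u0].
  by rewrite itvE -[X in measurable X]setTI; exact: mZ.
have k0 : 0 <= (t `^ (- a) - u `^ (- a)) / Gamma1.
  rewrite divr_ge0 ?(ltW Gamma1_gt0)// subr_ge0 !powRN lef_pV2 ?posrE
    ?powR_gt0//; [|lra..].
  by apply: ge0_ler_powR; [exact: ltW|rewrite nnegrE; lra|rewrite nnegrE;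
    lra|lra].
have mh : measurable_fun setT h by exact: continuous_measurable_fun.
apply: (@le_trans _ _ (\int[P]_w (Z w * expR (- Z w) * h (expR (- Z
  w)))%:E)%E); last first.
  rewrite -[X in (_ <= P X)%E]setIT -integral_indic//;
    apply: ge0_le_integral => //.
  - by move=> w _; rewrite lee_fin !mulr_ge0 ?expR_ge0// ltW.
  - apply/measurable_EFinP/measurable_funM; last first.
      by apply: measurableT_comp => //; apply: measurableT_comp => //;
        exact: measurable_funN.
    by apply: measurable_funM => //; apply: measurableT_comp => //;
      exact: measurable_funN.
  - by apply/measurable_EFinP; exact: measurable_indic.
  by move=> w _; rewrite lee_fin (le_trans (hup _)).
rewrite (stable_size_bias ch hC h0).
have q0 w w' : 0 <= a / Gamma1 * expR (- Z w) * `|L w'| `^ (- a)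
    * h (expR (- (Z w + `|L w'|))).
  by rewrite mulr_ge0// mulr_ge0 ?powR_ge0// mulr_ge0 ?expR_ge0// divr_ge0 ?ltW.
apply: (@le_trans _ _ (\int[P]_(w in [set w | (Z w < t0)%R]) cst (((t `^ (- a)
  - u `^ (- a)) / Gamma1)%:E) w)%E).
  by rewrite integral_cst// muleC.
rewrite [leLHS]integral_mkcond; apply: ge0_le_integral => //.
- by move=> w _; apply: erestrict_ge0 => w' _; rewrite lee_fin.
- exact/(measurable_restrictT _ _).1.
- apply: (@measurable_fun_fubini_tonelli_F _ _ T T' R P' (fun x : T * T' =>
    (a / Gamma1 * expR (- Z x.1) * `|L x.2| `^ (- a)
      * h (expR (- (Z x.1 + `|L x.2|))))%:E)).
    have mL : measurable_fun setT (fun x : T * T' => `|L x.2|).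
      by apply: measurableT_comp => //; exact: measurableT_comp.
    have mZ1 : measurable_fun setT (fun x : T * T' =>
      Z x.1) by exact: measurableT_comp.
    apply/measurable_EFinP/measurable_funM.
      apply: measurable_funM; last exact: (measurableT_comp (measurable_powR
        _)).
      apply: measurable_funM => //; apply: measurableT_comp => //.
      exact: measurable_funN.
    apply: measurableT_comp => //; apply: measurableT_comp => //;
      apply: measurable_funN.
    exact: measurable_funD.
  by move=> x; rewrite lee_fin.
move=> w _; rewrite patchE; case: ifPn => [|_]; last first.
  by apply: integral_ge0 => w' _; rewrite lee_fin.
rewrite inE/= => Zt0.
pose g (s : R) := a / Gamma1 * expR (- Z w) * s `^ (- a) * h (expR (- (Z w +
  s))).
have mg : measurable_fun setT g.
  apply: measurable_funM; first by apply: measurable_funM => //;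
    exact: measurable_powR.
  apply: measurableT_comp => //; apply: measurableT_comp => //;
    apply: measurable_funN.
  exact: measurable_funD.
have g0 s : 0 <= g s.
  by rewrite mulr_ge0// mulr_ge0 ?powR_ge0// mulr_ge0 ?expR_ge0// divr_ge0 ?ltW.
rewrite (ge0_integral_exponential_norm hL mg g0) (ge0_integral_exponential hL
  mg g0).
(* [f] is the lower bound of the integrand obtained by replacing x^(- a) with (Z + x)^(- a); [F] is
   its primitive. *)
pose f x := a / Gamma1 * (Z w + x) `^ (- a - 1).
pose F x := - (Gamma1^-1 * (Z w + x) `^ (- a)).
have Z0 := Z_gt0 w.
have dF x : t - Z w <= x <= u - Z w -> is_derive x 1 F (f x).
  move=> /andP[tx _]; have Zx : 0 < Z w + x by lra.
  have d1 : is_derive x 1 (fun y => Z w + y) 1.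
    by have := is_deriveD (is_derive_cst (Z w) x 1) (is_derive_id x 1);
      rewrite add0r.
  have d2 := @is_derive1_comp R (fun y => y `^ (- a)) (fun y => Z w + y) x _ _
    (is_derive1_powR _ Zx) d1.
  apply: is_derive_eq (is_deriveN (is_deriveZ Gamma1^-1 d2)) _.
  by rewrite /f /GRing.scale/=; ring.
have cf x : t - Z w <= x <= u - Z w -> {for x, continuous f}.
  move=> /andP[tx _]; have Zx : 0 < Z w + x by lra.
  apply: continuousM; first exact: cst_continuous.
  apply: (@continuous_comp _ _ _ (fun y => Z w + y) (fun y => y `^ (- a - 1))).
    by apply: continuousD; [exact: cst_continuous|exact: cvg_id].
  exact: continuous_powR.
have ab : t - Z w < u - Z w by lra.
rewrite /cst (_ : (t `^ (- a) - u `^ (- a)) / Gamma1 = F (u - Z w) - F (t - Z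
  w)); last first.
  by rewrite /F !(addrC (Z w)) !subrK; ring.
rewrite -(is_derive_FTC2 ab dF cf).
apply: (@le_trans _ _ (\int[lebesgue_measure]_(x in `[(t - Z w)%R, (u - Z w)%R])
  (g x * expR (- x))%:E)%E); last first.
  apply: ge0_subset_integral => //.
  - apply/measurable_EFinP/measurable_funTS/measurable_funM => //.
    exact: measurableT_comp.
  - by move=> x _; rewrite lee_fin mulr_ge0 ?expR_ge0.
  - by move=> x; rewrite /= !in_itv/= andbT; lra.
apply: ge0_le_integral => //.
- by move=> x _; rewrite lee_fin mulr_ge0 ?powR_ge0// divr_ge0 ?ltW.
- apply/measurable_EFinP/measurable_funTS/measurable_funM => //.
  by apply: (measurableT_comp (measurable_powR _)); exact: measurable_funD.
- apply/measurable_EFinP/measurable_funTS/measurable_funM => //.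
  exact: measurableT_comp.
move=> x; rewrite /= in_itv/= => /andP[tx xu].
have Zx : 0 < Z w + x by lra.
have x0 : 0 < x by lra.
rewrite lee_fin /g /f hlow; last by lra.
(* The weight exp (- Z), the density exp (- x) and the factor exp (Z + x) of the cutoff cancel. *)
rewrite (_ : expR (Z w + x) = expR (Z w) * expR x) ?expRD// !expRN.
rewrite [leRHS](_ : _ = a / Gamma1 * (x `^ (- a) / (Z w + x))); last first.
  by field; rewrite !gt_eqF ?expR_gt0.
rewrite ler_wpM2l ?divr_ge0 ?(ltW Gamma1_gt0) ?(ltW a_gt0)//.
rewrite powRD ?(gt_eqF Zx) ?implybT// powR_inv1 ?(ltW Zx)//.
rewrite ler_wpM2r ?invr_ge0 ?(ltW Zx)// !powRN lef_pV2 ?posrE ?powR_gt0//.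
by apply: ge0_ler_powR; [exact: ltW|rewrite nnegrE; lra|rewrite nnegrE;
  lra|lra].
Qed.

(** * Exponential bound for the survival function of Z^(- a) *)

Lemma ler_powRN (x y : R) : 0 < x -> x <= y -> y `^ (- a) <= x `^ (- a).
Proof.
move=> x0 xy; rewrite !powRN lef_pV2 ?posrE ?powR_gt0 ?(lt_le_trans x0)//.
by apply: ge0_ler_powR; rewrite ?nnegrE ?(ltW a_gt0)// ltW// (lt_le_trans x0).
Qed.

Lemma powRNK (y : R) : 0 < y -> (y `^ (- a^-1)) `^ (- a) = y.
Proof. by move=> y0; rewrite -powRrM mulrNN mulVf ?gt_eqF// powRr1// ltW. Qed.

Let survival_set (y : R) := [set w | y <= Z w `^ (- a)].

Let measurable_survival_set y : measurable (survival_set y).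
Proof.
have mN : measurable_fun setT (fun w => Z w `^ (- a)).
  exact: (measurableT_comp (measurable_powR _)).
rewrite (_ : survival_set y = (fun w => Z w `^ (- a)) @^-1` `[y, +oo[);
  last first.
  by apply/seteqP; split => w /=; rewrite in_itv/= andbT.
by rewrite -[X in measurable X]setTI; exact: mN.
Qed.

Let survival y := fine (P (survival_set y)).

Let survivalE y : P (survival_set y) = (survival y)%:E.
Proof. by rewrite /survival fineK// fin_num_measure. Qed.

Let survival_ge0 y : 0 <= survival y.
Proof. by rewrite fine_ge0. Qed.

Let survival_le1 y : survival y <= 1.
Proof. by rewrite -lee_fin -survivalE probability_le1. Qed.

(** In the scale y -> y^(- 1 / a) the increment t^(- a) - u^(- a) becomes a difference of levels.
    The events Z < t0 and t0 <= Z <= u0 are disjoint; the first contains the survival event at [c],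
    and both lie in the one at [b]. *)
Lemma survival_step (b c : R) : 0 < b -> b < c ->
  survival c * (1 + (c - b) / Gamma1) <= survival b.
Proof.
move=> b0 bc.
have step e : 0 < e -> e < c - b -> survival c * (1 + e / Gamma1) <= survival b.
  (* The levels c - del > c - 2 del > b + del > b correspond to t0 < t < u < u0; the middle gap is
     exactly [e]. *)
  move=> e0 ecb; pose del := (c - b - e) / 3.
  have del0 : 0 < del by rewrite /del; lra.
  have edel : e = c - 2 * del - (b + del) by rewrite /del; lra.
  pose tau y := y `^ (- a^-1).
  have tau_gt0 y : 0 < y -> 0 < tau y by exact: powR_gt0.
  have tau_lt x y : 0 < x -> x < y -> tau y < tau x.
    move=> x0 xy; have y0 := lt_trans x0 xy.
    rewrite /tau !powRN ltf_pV2 ?posrE ?powR_gt0//.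
    by apply: gt0_ltr_powR; rewrite ?nnegrE ?invr_gt0// ltW.
  have h1 : 0 < c - del by lra.
  have h2 : 0 < c - 2 * del by lra.
  have h3 : 0 < b + del by lra.
  have t0t : tau (c - del) < tau (c - 2 * del) by apply: tau_lt; lra.
  have tu : tau (c - 2 * del) < tau (b + del) by apply: tau_lt; lra.
  have uu0 : tau (b + del) < tau b by apply: tau_lt; lra.
  have := stable_prob_increment (tau_gt0 _ h1) t0t tu uu0.
  rewrite !powRNK// -edel.
  set A := [set w | _]; set B := [set w | _].
  have mA : measurable A.
    rewrite (_ : A = Z @^-1` `]-oo, tau (c - del)[); last first.
      by apply/seteqP; split => w /=; rewrite in_itv.
    by rewrite -[X in measurable X]setTI; exact: mZ.
  have mB : measurable B.
    rewrite (_ : B = Z @^-1` `[tau (c - del), tau b]); last first.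
      by apply/seteqP; split => w /=; rewrite in_itv.
    by rewrite -[X in measurable X]setTI; exact: mZ.
  have cA : (P (survival_set c) <= P A)%E.
    apply: le_measure; rewrite ?inE// => w /= cw; rewrite /A/= ltNge;
      apply/negP => Zw.
    have := ler_powRN (tau_gt0 _ h1) Zw; rewrite powRNK//; move: cw;
      rewrite /survival_set/=; lra.
  have ABb : (P A + P B <= P (survival_set b))%E.
    rewrite -measureU//.
      apply: le_measure; rewrite ?inE//; first exact: measurableU.
      have t0u0 : tau (c - del) < tau b by apply: tau_lt; lra.
      move=> w ABw; rewrite /survival_set/= -(powRNK b0).
      apply: ler_powRN => //.
      by case: ABw => /= [Zw|/andP[]//]; rewrite ltW// (lt_trans Zw).
    by apply/seteqP; split => // w [/= wA /andP[]]; rewrite leNgt wA.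
  have EA : P A = (fine (P A))%:E by rewrite fineK// fin_num_measure.
  have EB : P B = (fine (P B))%:E by rewrite fineK// fin_num_measure.
  move: cA ABb; rewrite !survivalE EA EB -EFinM -EFinD !lee_fin => cA ABb ABe.
  rewrite (le_trans _ ABb)// mulrDr mulr1 lerD//.
  by rewrite (le_trans _ ABe)// ler_wpM2r// divr_ge0 ?ltW.
apply/ler_addgt0Pr => e e0.
(* [e'] tends to c - b: the first entry keeps it positive, the second makes the loss (c - b - e') /
   Gamma1 at most [e]. As the survival function is at most 1, the total loss is at most [e]. *)
pose e' := Num.max ((c - b) / 2) (c - b - e * Gamma1).
have e'0 : 0 < e' by rewrite lt_max; apply/orP; left; lra.
have e'1 : e' < c - b.
  by rewrite gt_max; apply/andP; split; [lra|rewrite ltrBlDr ltrDl mulr_gt0].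
have e'2 : c - b - e * Gamma1 <= e' by rewrite le_max lexx orbT.
have := step _ e'0 e'1.
have e'3 : (c - b) / Gamma1 <= e' / Gamma1 + e.
  by rewrite ler_pdivrMr// mulrDl divfK ?gt_eqF//; lra.
have : survival c * ((c - b) / Gamma1) <= survival c * (e' / Gamma1) + e.
  apply: (@le_trans _ _ (survival c * (e' / Gamma1 + e)));
    first exact: ler_wpM2l.
  by rewrite mulrDr lerD2l -[leRHS]mul1r ler_wpM2r// ltW.
by rewrite !mulrDr; lra.
Qed.

Lemma survival_le_expR (x : R) : 0 < x -> survival x <= expR (- (x / Gamma1)).
Proof.
move=> x0; set y := x / Gamma1; have y0 : 0 < y by rewrite divr_gt0.
(* The progression starts at [e], since [survival_step] requires a positive lower level; hence n
   factors for n + 1 multiples, a loss that disappears in the limit. *)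
have iter n (e : R) : 0 < e -> survival (n.+1%:R * e) * (1 + e / Gamma1) ^+ n
  <= 1.
  move=> e0; have q0 : 0 <= 1 + e / Gamma1 by rewrite addr_ge0// divr_ge0 ?ltW.
  elim: n => [|n IH]; first by rewrite expr0 mulr1.
  apply: le_trans IH; rewrite exprS mulrA ler_wpM2r ?exprn_ge0//.
  have := @survival_step (n.+1%:R * e) (n.+2%:R * e).
  rewrite -mulrBl -natrB// subSnn mul1r; apply; first exact: mulr_gt0.
  by rewrite ltr_pM2r// ltr_nat.
apply/ler_addgt0Pr => e e0.
suff [n nE] : exists n : nat, survival x <= expR (- y) + e by [].
(* With q = y / (n + 1), [expR_le_1D] gives (1 + q)^n >= exp (n q / (1 + q)), and n q / (1 + q) = n
   y / (n + 1 + y) tends to [y]. *)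
have cvgE : expR (- (n%:R / (n.+1%:R + y) * y)) @[n --> \oo] --> expR (- y).
  apply: continuous_cvg; first exact: continuous_expR.
  have u0 : (n.+1%:R + y)^-1 @[n --> \oo] --> (0 : R).
    apply: (@squeeze_cvgr _ _ _ R (fun=> 0) (@harmonic R) _).
    - apply: nearW => n; rewrite invr_ge0 addr_ge0 ?(ltW y0)//=.
      by rewrite lef_pV2 ?posrE ?addr_gt0// lerDl ltW.
    - exact: cvg_cst.
    - exact: cvg_harmonic.
  have : (1 - (1 + y) * (n.+1%:R + y)^-1) * y @[n --> \oo] -->
    (1 - (1 + y) * 0) * y.
    apply: cvgMl; apply: cvgB; first exact: cvg_cst.
    by apply: cvgMr.
  rewrite mulr0 subr0 mul1r => /cvgN; apply: cvg_trans.
  apply: near_eq_cvg; apply: nearW => n; rewrite fctE; congr (- (_ * _)).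
  by rewrite -natr1; field; rewrite gt_eqF// addr_gt0// natr1.
have /cvgrPdist_le/(_ _ e0)[N _ /(_ N (leqnn N))/=] := cvgE.
rewrite ler_norml => /andP[NE _]; exists N.
apply: (@le_trans _ _ (expR (- (N%:R / (N.+1%:R + y) * y)))); last by lra.
have xN0 : 0 < x / N.+1%:R by exact: divr_gt0.
have := iter N _ xN0; rewrite (mulrC N.+1%:R) divfK ?pnatr_eq0//.
set q := x / N.+1%:R / Gamma1.
have qE : q = y / N.+1%:R by rewrite /q /y mulrAC.
have q0 : 0 <= q by rewrite qE divr_ge0// ltW.
move=> iterN.
rewrite expRN -[leRHS]mul1r ler_pdivlMr ?expR_gt0// (le_trans _ iterN)//
  ler_wpM2l//.
rewrite (_ : _ * y = q / (1 + q) *+ N); last first.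
  have m0 : 0 < N.+1%:R :> R by [].
  rewrite qE -mulr_natl; move: m0; set m := N.+1%:R => m0.
  by field; rewrite !gt_eqF// addr_gt0.
by rewrite -mulr_natr expRM_natr lerXn2r ?nnegrE ?expR_ge0 ?addr_ge0//
  expR_le_1D.
Qed.

(** * Factorization of the exponential law as Z^(- a) L^a with [Z] and [L] independent *)

Let X (x : T * T') := Z x.1 `^ (- a) * L x.2 `^ a.

Let measurable_X : measurable_fun setT X.
Proof.
apply: measurable_funM; apply: (measurableT_comp (measurable_powR _)).
  exact: measurableT_comp.
exact: measurableT_comp.
Qed.

(** For y >= 0 the event says L > y^(1 / a) Z, whose probability given [Z] is exp (- y^(1 / a) Z);
    the Laplace transform at y^(1 / a) then gives exp (- y). For y < 0 both sides are 1. *)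
Lemma stable_exponential_tail (y : R) :
  (\int[P]_w \int[P']_w' (\1_`]y, +oo[ (Z w `^ (- a) * L w' `^ a))%:E
    = \int[P']_w' (\1_`]y, +oo[ (L w'))%:E)%E.
Proof.
have powRaK (x : R) : 0 <= x -> (x `^ a^-1) `^ a = x.
  by move=> x0; rewrite -powRrM mulVf ?gt_eqF// powRr1.
have mg (z : R) : measurable_fun setT (fun x : R =>
  (\1_`]y, +oo[ (z `^ (- a) * x `^ a) : R)).
  apply: measurableT_comp => //; apply: measurable_funM => //;
    exact: measurable_powR.
have [y0|y0] := leP 0 y.
  rewrite (exponential_tail hL)// -[X in expR (- X)](powRaK _ y0) -laplaceZ
    ?powR_ge0//.
  apply: eq_integral => w _.
  have Z0 := Z_gt0 w.
  rewrite (ge0_integral_exponential hL (mg (Z w)))//.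
  rewrite -(exponential_tail hL) ?mulr_ge0 ?powR_ge0 ?ltW//
    (ge0_integral_exponential hL)//.
  apply: eq_integral => x; rewrite inE/= in_itv/= andbT => x0; congr (_ * _)%:E.
  rewrite !indicE; congr (_%:R); congr (nat_of_bool _).
  have yE : (y < Z w `^ (- a) * x `^ a) = (y `^ a^-1 * Z w < x).
    rewrite powRN [X in _ < X]mulrC ltr_pdivlMr ?powR_gt0//.
    have c0 : 0 <= y `^ a^-1 * Z w by rewrite mulr_ge0 ?powR_ge0 ?(ltW Z0).
    rewrite -[X in X * _](powRaK _ y0) -powRM ?powR_ge0 ?(ltW Z0)//.
    apply/idP/idP; last by apply: gt0_ltr_powR; rewrite ?nnegrE// ltW.
    apply: contraTT; rewrite -!leNgt.
    by apply: ge0_ler_powR; rewrite ?nnegrE// ltW.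
  by rewrite !mem_setE !in_itv/= !andbT yE.
transitivity (\int[P]_w 1)%E.
  apply: eq_integral => w _.
  transitivity (\int[P']_w' 1)%E; last by rewrite integral_cst// mul1e;
    exact: probability_setT.
  apply: eq_integral => w' _; rewrite indicE mem_set//= in_itv/= andbT.
  by rewrite (lt_le_trans y0)// mulr_ge0 ?powR_ge0.
rewrite integral_cst// mul1e [LHS]probability_setT.
rewrite (ge0_integral_exponential hL)//.
transitivity (\int[P']_w (\1_`]0, +oo[ (L w))%:E)%E.
  by rewrite (exponential_tail hL)// oppr0 expR0.
rewrite (ge0_integral_exponential hL)//.
apply: eq_integral => x; rewrite inE/= in_itv/= andbT => x0.
by rewrite !indicE !mem_set//= in_itv/= andbT// (lt_trans y0).
Qed.

(** The rays []y, +oo[] are stable under intersection and generate the Borel sets, so equal tails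
    give equal laws. Independence is realized on the product space. *)
Lemma stable_exponential_factorization (psi : R -> R) :
    measurable_fun setT psi -> (forall x, 0 <= psi x) ->
  (\int[P']_w' (psi (L w'))%:E
    = \int[P]_w \int[P']_w' (psi (Z w `^ (- a) * L w' `^ a))%:E)%E.
Proof.
move=> mpsi psi0.
have mX := measurable_X.
have mu_eq A : measurable A -> distribution P' L A = pushforward (P \x P')%E X
  A.
  apply: (measure_unique (@RGenOInfty.G R) (fun n : nat =>
    `](- n%:R : R), +oo[%classic)).
  - exact: RGenOInfty.measurableE.
  - move=> _ _ [x ->] [y ->]; exists (Num.max x y).
    by apply/seteqP; split => z /=; rewrite !in_itv/= !andbT gt_max => /andP.
  - by move=> n; exists (- n%:R).
  - apply/seteqP; split => // x _; exists (Num.bound `|x|) => //=.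
    rewrite in_itv/= andbT ltrNl (le_lt_trans _ (archi_boundP (normr_ge0 x)))//.
    by rewrite -normrN ler_norm.
  - move=> _ [y ->].
    have mY : measurable (X @^-1` `]y, +oo[).
      by rewrite -[X in measurable X]setTI; exact: mX.
    have mLY : measurable (L @^-1` `]y, +oo[).
      by rewrite -[X in measurable X]setTI; exact: measurable_funPT.
    transitivity (\int[P']_w' (\1_`]y, +oo[ (L w'))%:E)%E.
      transitivity (\int[P']_w' (\1_(L @^-1` `]y, +oo[) w')%:E)%E => //.
      by rewrite integral_indic// setIT.
    rewrite -stable_exponential_tail.
    transitivity (\int[P \x P']_x (\1_(X @^-1` `]y, +oo[) x)%:E)%E.
      rewrite fubini_tonelli1//.
      exact/measurable_EFinP/measurable_indic.
    by rewrite integral_indic// setIT.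
  - by move=> k; rewrite (le_lt_trans (probability_le1 _ _))// ltry.
have mpsiE : measurable_fun setT (EFin \o psi) by exact/measurable_EFinP.
transitivity (\int[distribution P' L]_x (psi x)%:E)%E.
  by rewrite ge0_integral_distribution.
rewrite (eq_measure_integral (pushforward (P \x P')%E X)) => [|A mA _];
  last exact: mu_eq.
transitivity (\int[P \x P']_z (psi (X z))%:E)%E.
  by rewrite ge0_integral_pushforward// => x _; rewrite lee_fin.
rewrite fubini_tonelli1//; first by apply/measurable_EFinP;
  exact: measurableT_comp.
by move=> x; rewrite lee_fin.
Qed.

(** * Optimality of the constant in the stochastic order *)

Lemma stable_optimal (c : R) : 1 < c ->
  ~ st_le P (fun w => c * Z w `^ (- a)) P' (fun w' => Gamma1 * L w').
Proof.
move=> c1 cle; have c0 : 0 < c by lra.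
pose k := c / Gamma1; have k0 : 0 < k by rewrite divr_gt0.
have tail (y : R) : 0 <= y -> (P [set w | (y <= Z w `^ (- a))%R] <= (expR (- (k
  * y)))%:E)%E.
  move=> y0; have := cle (c * y).
  rewrite (_ : [set w | _] = [set w | y <= Z w `^ (- a)]); last first.
    by apply/seteqP; split => w /=; rewrite ler_pM2l.
  rewrite (_ : [set w | c * y <= _] = [set w | k * y <= L w]); last first.
    by apply/seteqP; split => w /=; rewrite /k mulrAC ler_pdivrMr//
      (mulrC (L w)).
  by rewrite (exponential_prob_ge hL) (max_idPr _)// mulr_ge0// ltW.
have bound (x : R) : 0 <= x ->
    ((expR (- x))%:E <= \int[P']_w' (expR (- (k * x * L w' `^ (- a))))%:E)%E.
  move=> x0; rewrite -(exponential_tail hL)// -stable_exponential_tail.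
  (* Exchanging the integrals fixes [L], so that the assumed tail bound applies to Z^(- a) at level
     x / L^a. *)
  rewrite (@fubini_tonelli _ _ T T' R P P' (fun z : T * T' =>
    (\1_`]x, +oo[ (Z z.1 `^ (- a) * L z.2 `^ a))%:E)); last 2 first.
  - apply/measurable_EFinP; apply: measurableT_comp => //.
  - by move=> z; rewrite lee_fin.
  have mf := @measurable_fun_fubini_tonelli_G _ _ T T' R P (fun z : T * T' =>
    (\1_`]x, +oo[ (Z z.1 `^ (- a) * L z.2 `^ a))%:E).
  apply: ge0_le_integral => //.
  - by move=> w' _; apply: integral_ge0 => w _; rewrite lee_fin.
  - apply: mf; last by move=> z; rewrite lee_fin.
    by apply/measurable_EFinP; apply: measurableT_comp.
  - apply/measurable_EFinP; apply: measurableT_comp => //;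
      apply: measurable_funN.
    apply: measurable_funM => //; apply: (measurableT_comp (measurable_powR _)).
    exact: measurable_funPT.
  move=> w' _.
  have mS : measurable [set w | x / L w' `^ a <= Z w `^ (- a)].
    exact: measurable_survival_set.
  (* When L^a vanishes, the event on the left is empty, and L^(- a) is the inverse of 0, that is 0,
     so the right side is 1. *)
  have [La0|La0] := eqVneq (L w' `^ a) 0.
    rewrite powRN La0 invr0 mulr0 oppr0 expR0.
    rewrite [leLHS](_ : _ = 0)%E; first by rewrite lee_fin.
    apply: integral0_eq => w _; rewrite mulr0 indicE memNset//=.
    by rewrite in_itv/= andbT; apply/negP; rewrite -leNgt.
  have La : 0 < L w' `^ a by rewrite lt0r La0 powR_ge0.
  apply: (@le_trans _ _ (P [set w | (x / L w' `^ a <= Z w `^ (- a))%R])%E).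
    rewrite -[X in (_ <= P X)%E]setIT -integral_indic//.
    apply: ge0_le_integral => //.
    - apply/measurable_EFinP; apply: measurableT_comp => //.
      apply: measurable_funM => /=; last exact: measurable_cst.
      exact: (measurableT_comp (measurable_powR _) mZ).
    - exact/measurable_EFinP/measurable_indic.
    move=> w _; rewrite lee_fin !indicE ler_nat.
    case: (boolP (_ \in `]x, +oo[%classic)) => // h.
    rewrite mem_set//= ler_pdivrMr// ltW//.
    by move: h; rewrite inE/= in_itv/= andbT.
  by rewrite powRN -mulrA; apply: tail; rewrite divr_ge0// ltW.
pose q w' := k * L w' `^ (- a).
have q0 w' : 0 <= q w' by rewrite mulr_ge0 ?powR_ge0 ?ltW.
have mL : measurable_fun setT L by exact: measurable_funPT.
have mq : measurable_fun setT q.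
  by apply: measurable_funM => //; exact: (measurableT_comp (measurable_powR
    _)).
have intq : (\int[P']_w' (q w')%:E = c%:E)%E.
  rewrite /q; under eq_integral do rewrite EFinM.
  rewrite ge0_integralZl_EFin//; last 3 first.
  - by move=> w' _; rewrite lee_fin powR_ge0.
  - by apply/measurable_EFinP; exact: (measurableT_comp (measurable_powR _)).
  - exact: ltW.
  have := integral_exponential_powR hL (s := 1 - a).
  rewrite (_ : 1 - a - 1 = - a); last by ring.
  move=> ->; last by move: ha; lra.
  by rewrite -EFinM divfK// gt_eqF.
have iq : P'.-integrable setT (EFin \o q).
  apply/integrableP; split; first exact/measurable_EFinP.
  under eq_integral => w _ do rewrite gee0_abs ?lee_fin//.
  by rewrite intq ltry.
(* Difference quotients at 0 of m -> 1 - exp (- m q): they tend to [q], are dominated by [q], and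
   [bound] at x = 1 / (n + 1) keeps their means at most 1. In the limit the mean [c] of [q] is at
   most 1. *)
pose f n w' := n.+1%:R * (1 - expR (- (n.+1%:R^-1 * q w'))).
have n0 n : 0 < n.+1%:R :> R by [].
have f0 n w' : 0 <= f n w'.
  rewrite mulr_ge0// subr_ge0 expR_le1 oppr_le0 mulr_ge0// invr_ge0 ltW//.
have fq n w' : f n w' <= q w'.
  rewrite /f mulrC -ler_pdivlMr// mulrC.
  by have := expR_ge1Dx (- (q w' / n.+1%:R)); set r := _ / _; lra.
have mf n : measurable_fun setT (f n).
  apply: measurable_funM => //; apply: measurable_funB => //;
    apply: measurableT_comp => //.
  by apply: measurable_funN; exact: measurable_funM.
have cf w' : f n w' @[n --> \oo] --> q w'.
  have dE : is_derive (0 : R) 1 (fun m => - expR (- (m * q w'))) (q w').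
    have d1 : is_derive (0 : R) 1 (fun m => - (m * q w')) (- q w').
      by apply: is_derive_eq; rewrite scaler0 add0r /GRing.scale/= mulr1.
    have := is_deriveN (@is_derive1_comp R expR (fun m =>
      - (m * q w')) 0 _ _ (is_derive_expR _) d1).
    by rewrite mul0r oppr0 expR0 mul1r opprK.
  have := cvg_difference_quotient dE; apply: cvg_trans.
  apply: near_eq_cvg; apply: nearW => n.
  by rewrite /f mul0r oppr0 expR0 add0r opprK addrC.
have intf n : (\int[P']_w' (f n w')%:E <= 1)%E.
  have x0 : 0 <= n.+1%:R^-1 :> R by rewrite invr_ge0 ltW.
  have iE : P'.-integrable setT (fun w' => (expR (- (n.+1%:R^-1 * q w')))%:E).
    apply: (@le_integrable _ _ _ P' setT measurableT _ (cst 1%E)) => //.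
    - apply/measurable_EFinP; apply: measurableT_comp => //.
      by apply: measurable_funN; exact: measurable_funM.
    - move=> w' _ /=; rewrite lee_fin ger0_norm ?expR_ge0//
        normr1 expR_le1 oppr_le0.
      by rewrite mulr_ge0.
    - exact: finite_measure_integrable_cst.
  rewrite /f; under eq_integral do rewrite EFinM.
  rewrite integralZl//; last first.
    by under eq_fun do rewrite EFinB; apply: integrableB => //;
      exact: finite_measure_integrable_cst.
  under eq_integral do rewrite EFinB.
  rewrite integralB//; last exact: finite_measure_integrable_cst.
  rewrite integral_cst// [X in (1 * X)%E]probability_setT mule1.
  have := bound _ x0.
  rewrite [X in (_ <= X)%E -> _](_ : _ = \int[P']_w' (expR (- (n.+1%:R^-1 * q
    w')))%:E)%E; last first.
    by apply: eq_integral => w' _; rewrite /q mulrA (mulrC k).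
  have /fineK <- := integrable_fin_num measurableT iE.
  rewrite -EFinB -EFinM !lee_fin => h.
  rewrite mulrC -ler_pdivlMr// div1r.
  by have := expR_ge1Dx (- n.+1%:R^-1 : R); move: h; set r := _^-1; lra.
have [] // := @dominated_convergence _ _ _ P' setT measurableT
  (fun n w => (f n w)%:E) (EFin \o q) (EFin \o q).
- by move=> n; apply/measurable_EFinP.
- exact/measurable_EFinP.
- by apply: aeW => w' _; apply: cvg_EFin; [exact: nearW|exact: cf].
- by apply: aeW => w' n _; rewrite /= lee_fin ger0_norm.
move=> _ _ cvgf.
have : (\int[P']_w' (EFin \o q) w' <= 1)%E.
  rewrite -(cvg_lim _ cvgf)//; apply: lime_le; first by apply/cvg_ex; eexists;
    exact: cvgf.
  exact: nearW.
by rewrite intq lee_fin; lra.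
Qed.

(** * Convex order for the normalized variable *)

Let N w := Z w `^ (- a).

Let N_ge0 w : 0 <= N w. Proof. exact: powR_ge0. Qed.

Let mN : measurable_fun setT N.
Proof. exact: (measurableT_comp (measurable_powR _) mZ). Qed.

Let mL : measurable_fun setT L. Proof. exact: measurable_funPT. Qed.

Let Gamma2 := Gamma (1 + a).

Let Gamma2_gt0 : 0 < Gamma2.
Proof. by apply: Gamma_gt0; move: ha; lra. Qed.

Let integral_La : (\int[P']_w' (L w' `^ a)%:E = Gamma2%:E)%E.
Proof.
have := integral_exponential_powR hL (s := 1 + a).
by rewrite (_ : 1 + a - 1 = a); [apply; move: ha; lra|ring].
Qed.

Let integrable_La : P'.-integrable setT (fun w' => (L w' `^ a)%:E).
Proof.
apply/integrableP; split.
  by apply/measurable_EFinP; exact: (measurableT_comp (measurable_powR _)).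
under eq_integral => w _ do rewrite gee0_abs ?lee_fin ?powR_ge0//.
by rewrite integral_La ltry.
Qed.

(** Gamma2 m is the mean of m L^a, so integrating the support line of [psi] at that point gives the
    bound; an infinite right side is treated apart. *)
Lemma conditional_jensen (psi : R -> R) (m : R) :
    convex_function (setT : set R) psi -> (forall x, 0 <= psi x) ->
  ((psi (Gamma2 * m))%:E <= \int[P']_w' (psi (m * L w' `^ a))%:E)%E.
Proof.
move=> psi_convex psi0.
have mpsi := measurable_convex psi_convex.
have mLa : measurable_fun setT (fun w' => L w' `^ a).
  exact: (measurableT_comp (measurable_powR _)).
have mf : measurable_fun setT (fun w' => psi (m * L w' `^ a)).
  by apply: measurableT_comp => //; exact: measurable_funM.
have [fin|] := ltP (\int[P']_w' (psi (m * L w' `^ a))%:E)%E +oo%E; last first.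
  by apply: le_trans; exact: leey.
have [p hp] := convex_support psi_convex (Gamma2 * m).
pose u := psi (Gamma2 * m) - p * (Gamma2 * m).
have iu : P'.-integrable setT (fun=> u%:E) by exact:
  finite_measure_integrable_cst.
have iv : P'.-integrable setT (fun w' => (p * m)%:E * (L w' `^ a)%:E)%E.
  exact: integrableZl.
apply: (@le_trans _ _ (\int[P']_w' (u%:E + (p * m)%:E * (L w' `^ a)%:E))%E).
  rewrite integralD// integralZl// integral_La integral_cst//.
  rewrite [X in (_ * X)%E]probability_setT mule1 -EFinM -EFinD lee_fin /u.
  by rewrite le_eqVlt; apply/orP; left; apply/eqP; ring.
apply: le_integral => //.
- exact: integrableD.
- by apply: ge0_integrable => //.
- move=> w' _; rewrite -EFinM -EFinD lee_fin (le_trans _ (hp _))// /u.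
  by rewrite le_eqVlt; apply/orP; left; apply/eqP; ring.
Qed.

(** The absolute value makes the test function nonnegative, as the factorization demands. The
    identity yields both the integrability of [N] and the equality of the means. *)
Let abs_moments : (\int[P']_w' (`|L w'|)%:E = \int[P]_w (Gamma2 * N w)%:E)%E.
Proof.
rewrite (stable_exponential_factorization (psi := fun x => `|x|))//.
apply: eq_integral => w _.
under eq_integral => w' _ do rewrite ger0_norm ?mulr_ge0 ?powR_ge0// EFinM.
rewrite ge0_integralZl_EFin ?powR_ge0//.
- by rewrite integral_La -EFinM mulrC.
- by move=> w' _; rewrite lee_fin powR_ge0.
- by apply/measurable_EFinP; exact: (measurableT_comp (measurable_powR _)).
Qed.

Let integrable_normL : P'.-integrable setT (fun w' => (`|L w'|)%:E).
Proof.
apply: ge0_integrable => //; first exact: measurableT_comp.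
rewrite (ge0_integral_exponential hL (g := fun x => `|x|))//.
rewrite (_ : integral _ _ _ = (Gamma 2 : R)%:E) ?ltry// -integral_Gamma//.
apply: eq_integral => x; rewrite inE/= in_itv/= andbT => x0.
by rewrite gtr0_norm// (_ : 2 - 1 = 1) ?powRr1 ?(ltW x0)//; lra.
Qed.

Let integrable_L : P'.-integrable setT (fun w' => (L w')%:E).
Proof.
apply: le_integrable integrable_normL => //; first exact/measurable_EFinP.
by move=> w' _; rewrite /= lee_fin normr_id.
Qed.

Let integral_L : (\int[P']_w' (L w')%:E = \int[P]_w (Gamma2 * N w)%:E)%E.
Proof.
rewrite -abs_moments; apply: ae_eq_integral => //.
- exact/measurable_EFinP.
- by apply/measurable_EFinP; exact: measurableT_comp.
- by apply: filterS (exponential_ae_gt0 hL) => w' w0 _; rewrite gtr0_norm.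
Qed.

Let integrable_N : P.-integrable setT (fun w => (Gamma2 * N w)%:E).
Proof.
apply: ge0_integrable => //; first exact: measurable_funM.
  by move=> w; rewrite mulr_ge0// ltW.
by rewrite -abs_moments; move/integrable_lty: integrable_normL; apply.
Qed.

Lemma stable_convex (phi : R -> R) : convex_function (setT : set R) phi ->
  (\int[P]_w (phi (Gamma2 * N w))%:E <= \int[P']_w' (phi (L w'))%:E)%E.
Proof.
move=> phi_convex; have mphi := measurable_convex phi_convex.
have [p hp] := convex_support phi_convex 1.
(* Removing the support line [l] at 1 leaves a nonnegative convex [psi], to which factorization and
   conditional Jensen apply; [l] contributes equally to both sides because the means agree. *)
pose l x := phi 1 - p + p * x; pose psi x := phi x - l x.
have psi_convex : convex_function (setT : set R) psi by exact:
  convex_sub_affine.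
have mpsi := measurable_convex psi_convex.
have psi0 x : 0 <= psi x by rewrite /psi /l; have := hp x; lra.
have phiE x : phi x = psi x + l x by rewrite /psi subrK.
have mGN : measurable_fun setT (fun w => Gamma2 * N w) by exact:
  measurable_funM.
have il d0 (T0 : measurableType d0) (P0 : probability T0 R) (Y : T0 -> R) :
    P0.-integrable setT (fun w => (Y w)%:E) ->
    P0.-integrable setT (fun w => (l (Y w))%:E).
  move=> iY; rewrite /l; under eq_fun do rewrite EFinD EFinM.
  by apply: integrableD => //; [exact: finite_measure_integrable_cst|exact:
    integrableZl].
have intl d0 (T0 : measurableType d0) (P0 : probability T0 R) (Y : T0 -> R) :
    P0.-integrable setT (fun w => (Y w)%:E) ->
    (\int[P0]_w (l (Y w))%:E = (phi 1 - p)%:E + p%:E * \int[P0]_w (Y w)%:E)%E.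
  move=> iY; rewrite /l; under eq_integral do rewrite EFinD EFinM.
  rewrite integralD//; last 2 first.
  - exact: finite_measure_integrable_cst.
  - exact: integrableZl.
  by rewrite integralZl// integral_cst// [X in (_ * X)%E]probability_setT mule1.
have psi_le : (\int[P]_w (psi (Gamma2 * N w))%:E <= \int[P']_w' (psi (L
  w'))%:E)%E.
  rewrite (stable_exponential_factorization mpsi psi0).
  apply: ge0_le_integral => //.
  - by move=> w _; rewrite lee_fin.
  - by apply/measurable_EFinP; exact: measurableT_comp.
  - apply: (@measurable_fun_fubini_tonelli_F _ _ T T' R P' (fun x : T * T' =>
      (psi (Z x.1 `^ (- a) * L x.2 `^ a))%:E)).
      by apply/measurable_EFinP; exact: measurableT_comp.
    by move=> x; rewrite lee_fin.
  - by move=> w _; exact: conditional_jensen.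
have mpsiL : measurable_fun setT (fun w' =>
  psi (L w')) by exact: measurableT_comp.
have mphiL : measurable_fun setT (fun w' =>
  phi (L w')) by exact: measurableT_comp.
have [fin|inf] := ltP (\int[P']_w' (psi (L w'))%:E)%E +oo%E.
  under eq_integral do rewrite phiE EFinD.
  under [leRHS]eq_integral do rewrite phiE EFinD.
  have i1 : P'.-integrable setT (fun w' =>
    (psi (L w'))%:E) by exact: ge0_integrable.
  have i2 : P.-integrable setT (fun w => (psi (Gamma2 * N w))%:E).
    by apply: ge0_integrable => //; [exact: measurableT_comp|exact: le_lt_trans
      fin].
  rewrite integralD//; last exact: il.
  rewrite integralD//; last exact: il.
  by rewrite !intl// integral_L leeD2r.
(* The negative part of phi (L) is integrable, being dominated by the absolute value of l (L). Were
   the positive part integrable too, psi (L) = phi (L) - l (L) would have a finite mean. *)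
suff -> : (\int[P']_w' (phi (L w'))%:E = +oo)%E by exact: leey.
pose phip x := Num.max (phi x) 0; pose phin x := Num.max (- phi x) 0.
have iphin : P'.-integrable setT (fun w' => (phin (L w'))%:E).
  apply: le_integrable (integrable_abse (il _ _ _ _ integrable_L)) => //.
  - apply/measurable_EFinP; apply: measurable_maxr => //.
    exact: measurable_funN.
  move=> w' _; rewrite /= lee_fin normr_id ger0_norm /phin ?le_max ?lexx
    ?orbT//.
  rewrite ge_max normr_ge0 andbT.
  by rewrite -normrN (le_trans _ (ler_norm _))// lerN2 phiE lerDr.
have mphip : measurable_fun setT (fun w' =>
  phip (L w')) by exact: measurable_maxr.
rewrite integralE.
have -> : (\int[P']_w' ((fun w => (phi (L w))%:E)^\+ w') = +oo)%E.
  apply/eqP; rewrite -leye_eq leNgt; apply/negP => fin.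
  have iphip : P'.-integrable setT (fun w' => (phip (L w'))%:E).
    apply: ge0_integrable => //; first by move=> w';
      rewrite /phip le_max lexx orbT.
    apply: le_lt_trans fin; rewrite le_eqVlt; apply/orP; left; apply/eqP.
    by apply: eq_integral => w' _; rewrite funeposE -EFin_max.
  have iphi : P'.-integrable setT (fun w' => (phi (L w'))%:E).
    have phiB x : phi x = phip x - phin x.
      rewrite /phip /phin; have [h|h] := leP 0 (phi x).
        by rewrite (max_idPr _) ?subr0// oppr_le0.
      by rewrite (max_idPl _) ?sub0r ?opprK// oppr_ge0 ltW.
    by under eq_fun do rewrite phiB EFinB; exact: integrableB.
  have : P'.-integrable setT (fun w' => (psi (L w'))%:E).
    by under eq_fun do rewrite EFinB; apply: integrableB => //; exact: il.
  by move=> /integrable_lty h; have := h measurableT; rewrite ltNge inf.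
rewrite (_ : integral _ _ _ = \int[P']_w' (phin (L w'))%:E)%E; last first.
  by apply: eq_integral => w' _; rewrite funenegE -EFinN -EFin_max.
have /fineK <- := integrable_fin_num measurableT iphin.
by rewrite addye.
Qed.

End stable.

(** * From the Mittag-Leffler law to a stable variable on the same space *)

Section transfer.
Context d (T : measurableType d) (R : realType) (P : probability T R).

Lemma probability_ae_eq (A B : set T) : measurable A -> measurable B ->
  {ae P, forall w, A w <-> B w} -> P A = P B.
Proof.
move=> mA mB AB; rewrite -[in LHS](setIT A) -[in RHS](setIT B)
  -!integral_indic//.
apply: ae_eq_integral => //.
- exact/measurable_EFinP/measurable_indic.
- exact/measurable_EFinP/measurable_indic.
apply: filterS AB => w ABw _; congr EFin; rewrite !indicE; congr (_%:R);
  congr nat_of_bool.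
by apply/idP/idP; rewrite !inE => /ABw.
Qed.

Lemma ge0_integral_same_law d' (T' : measurableType d') (Q : probability T' R)
    (X : {RV P >-> R}) (Y : T' -> R) (g : R -> R) :
    measurable_fun setT Y -> same_law P X Q Y ->
    measurable_fun setT g -> (forall x, 0 <= g x) ->
  (\int[P]_w (g (X w))%:E = \int[Q]_w (g (Y w))%:E)%E.
Proof.
move=> mY XY mg g0.
have mgE : measurable_fun setT (EFin \o g) by exact/measurable_EFinP.
transitivity (\int[distribution P X]_x (g x)%:E)%E.
  by rewrite ge0_integral_distribution.
rewrite (eq_measure_integral (pushforward Q Y)) => [|A mA _]; last exact: XY.
by rewrite ge0_integral_pushforward// => x _; rewrite lee_fin.
Qed.

(** The stable variable is rebuilt on the space of [M] as M^(- 1 / a), and its Laplace transform is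
    read off through the common law. *)
Lemma mittag_leffler_stable (a : R) (M : {RV P >-> R}) : 0 < a ->
  mittag_leffler a M ->
  exists Z : T -> R, [/\ measurable_fun setT Z, forall w, 0 < Z w,
    forall l, 0 <= l ->
      (\int[P]_w (expR (- (l * Z w)))%:E = (expR (- (l `^ a)))%:E)%E &
    {ae P, forall w, M w = Z w `^ (- a)}].
Proof.
move=> a0 [d' [T' [Q [Y [[Y_gt0 laplaceY] MY]]]]].
(* Nonpositive values of [M], which form a null event, are replaced by 1, making [Z] positive
   everywhere. *)
pose rho (x : R) : R := if 0 < x then x else 1.
have rho_gt0 x : 0 < rho x by rewrite /rho; case: ifPn.
have mrho : measurable_fun setT rho.
  apply: measurable_fun_ifT => //.
  exact: measurable_fun_ltr.
have mYa : measurable_fun setT (fun w => Y w `^ (- a)).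
  exact: (measurableT_comp (measurable_powR _)).
have mrhoM : measurable_fun setT (fun w =>
  rho (M w)) by exact: measurableT_comp.
exists (fun w => rho (M w) `^ (- a^-1)); split.
- exact: (measurableT_comp (measurable_powR _)).
- by move=> w; rewrite powR_gt0.
- move=> l l0; rewrite -laplaceY// unlock.
  pose g x := expR (- (l * rho x `^ (- a^-1))).
  have mg : measurable_fun setT g.
    apply: measurableT_comp => //; apply: measurable_funN;
      apply: measurable_funM => //.
    exact: (measurableT_comp (measurable_powR _)).
  rewrite (ge0_integral_same_law mYa MY mg) => [|x]; last exact: expR_ge0.
  apply: ae_eq_integral => //.
  + by apply/measurable_EFinP; exact: (measurableT_comp mg).
  + apply/measurable_EFinP; apply: measurableT_comp => //;
      apply: measurable_funN.
    exact: measurable_funM.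
  apply: filterS Y_gt0 => w Yw _; rewrite /g /rho powR_gt0//.
  by rewrite -powRrM mulrNN mulfV ?gt_eqF// powRr1// ltW.
have mS : measurable [set w | M w <= 0].
  rewrite (_ : mkset _ = M @^-1` `]-oo, 0]); last first.
    by apply/seteqP; split => w /=; rewrite in_itv.
  by rewrite -[X in measurable X]setTI; exact: measurable_funPT.
(* The law carries this event to Y^(- a) <= 0, which forces Y <= 0 and is therefore null. *)
exists [set w | M w <= 0]; split => //.
  have := MY `]-oo, 0]%classic (measurable_itv _).
  rewrite /pushforward (_ : M @^-1` _ = [set w | M w <= 0]); last first.
    by apply/seteqP; split => w /=; rewrite in_itv.
  move=> ->; case: Y_gt0 => B [mB B0 YB].
  apply/eqP; rewrite eq_le measure_ge0 andbT -B0; apply: le_measure;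
    rewrite ?inE//.
    by rewrite -[X in measurable X]setTI; exact: mYa.
  move=> w /=; rewrite in_itv/= => Yw; apply: YB => /= Yw0.
  by move: Yw; rewrite leNgt powR_gt0.
move=> w /= Mw; rewrite leNgt; apply/negP => Mw0; apply: Mw.
by rewrite /rho Mw0 -powRrM mulrNN mulVf ?gt_eqF// powRr1// ltW.
Qed.

End transfer.

Theorem theoremC (R : realType) (a : R) (ha : 0 < a < 1)
    (dM : measure_display) (TM : measurableType dM) (PM : probability TM R)
    (M : {RV PM >-> R}) (hM : mittag_leffler a M)
    (dL : measure_display) (TL : measurableType dL) (PL : probability TL R)
    (L : {RV PL >-> R}) (hL : unit_exponential L) :
  optimal_st PM M PL (fun w => Gamma (1 - a) * L w) /\
  cx_le PM (fun w => Gamma (1 + a) * M w) PL L.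
Proof.
have [a0 a1] := andP ha.
have [Z [mZ Z0 laplaceZ MZ]] := mittag_leffler_stable a0 hM.
have G0 : 0 < Gamma (1 - a) by apply: Gamma_gt0; lra.
have mZa : measurable_fun setT (fun w => Z w `^ (- a)).
  exact: (measurableT_comp (measurable_powR _)).
have mge (X : TM -> R) x : measurable_fun setT X ->
  measurable [set w | x <= X w].
  move=> mX; rewrite (_ : mkset _ = X @^-1` `[x, +oo[); last first.
    by apply/seteqP; split => w /=; rewrite in_itv/= andbT.
  by rewrite -[X in measurable X]setTI; exact: mX.
(* The factor [c] serves twice: c = 1 for the stochastic order, c > 1 for optimality. *)
have tailM c x : PM [set w | x <= c * M w] = PM [set w | x <= c * Z w `^ (- a)].
  apply: probability_ae_eq; [apply: mge; exact: measurable_funM..|].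
  by apply: filterS MZ => w /= ->.
split; last first.
  move=> phi phi_convex _ _; rewrite unlock.
  apply: le_trans (stable_convex ha mZ Z0 laplaceZ hL phi_convex).
  rewrite le_eqVlt; apply/orP; left; apply/eqP.
  have mphi := measurable_convex phi_convex.
  apply: ae_eq_integral => //.
  - apply/measurable_EFinP; apply: (measurableT_comp mphi);
      exact: measurable_funM.
  - apply/measurable_EFinP; apply: (measurableT_comp mphi);
      exact: measurable_funM.
  by apply: filterS MZ => w /= -> _.
split.
  move=> x; have := tailM 1 x.
  rewrite (_ : [set w | x <= 1 * M w] = [set w | x <= M w]); last first.
    by apply/seteqP; split => w /=; rewrite mul1r.
  rewrite (_ : [set w | x <= 1 * Z w `^ (- a)] = [set w | x <= Z w `^ (- a)]);
    last first.
    by apply/seteqP; split => w /=; rewrite mul1r.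
  move=> ->.
  rewrite (_ : [set w | x <= _ * L w] = [set w | x / Gamma (1 - a) <= L w]);
    last first.
    by apply/seteqP; split => w /=; rewrite ler_pdivrMr// mulrC.
  rewrite (exponential_prob_ge hL).
  (* For x > 0 this is the exponential survival bound; for x <= 0 the exponential tail is 1. *)
  have [x0|x0] := ltP 0 x.
    have y0 : 0 <= x / Gamma (1 - a) by rewrite divr_ge0 ?ltW.
    rewrite (max_idPr y0).
    have := survival_le_expR ha mZ Z0 laplaceZ hL x0.
    by rewrite -lee_fin fineK// fin_num_measure//; exact: mge.
  have y0 : x / Gamma (1 - a) <= 0 by rewrite ler_pdivrMr// mul0r.
  by rewrite (max_idPl y0) oppr0 expR0 probability_le1//; exact: mge.
move=> [c [c1 cle]]; apply: (stable_optimal ha mZ Z0 laplaceZ hL c1) => x.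
by rewrite -tailM; exact: cle.
Qed.
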